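(* Let $\mathcal K$ be finite or countably infinite, and let $\mathcal K$, $(\mathsf Z_k,\mathcal A_k,\Psi_k,\Phi_k)$, $(\mathsf X,\mathcal B,\Pi)$ and $P$ (with $\Pi P=\Pi$) be as in the context. Let $t$ be a positive integer and suppose that for each $k\in\mathcal K$ there is a Markov transition kernel $P_k:\mathsf Z_k\times\mathcal A_k\to[0,1]$ and a constant $c_k>0$ such that (i) $\Phi_kP_k=\Phi_k$, (ii) $\|P_k^t\|_{\Phi_k}<1$, (iii) $P((k,z),\{k\}\times A)\ge c_kP_k(z,A)$ for all $z\in\mathsf Z_k$, $A\in\mathcal A_k$. Then $$1-\|P^t\|_\Pi^4\ \ge\ \Big(\inf_{k\in\mathcal K}c_k^t\Big)^2\Big(1-\sup_{k\in\mathcal K}\|P_k^t\|_{\Phi_k}^2\Big)\big[1-\lambda_1(M_P)\big].$$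
   Context: $\mathcal K$ is a finite or countably infinite set; for each $k\in\mathcal K$, $(\mathsf Z_k,\mathcal A_k)$ is a nonempty measurable space, $\Psi_k$ a nonzero finite measure on it with $\sum_{k}\Psi_k(\mathsf Z_k)<\infty$, and $\Phi_k=\Psi_k/\Psi_k(\mathsf Z_k)$. $\mathsf X=\bigcup_k\{k\}\times\mathsf Z_k$, $\mathcal B$ is generated by the sets $\{k\}\times A$ ($A\in\mathcal A_k$), and $\Pi(\{k\}\times A)=\Psi_k(A)/\sum_{k'}\Psi_{k'}(\mathsf Z_{k'})$. $P$ is a Markov transition kernel (Mtk) on $(\mathsf X,\mathcal B)$ with $\Pi P=\Pi$. For a probability measure $\omega$ and an Mtk $T$ with $\omega T=\omega$, $\|T\|_\omega$ is the operator norm of $f\mapsto\int T(\cdot,dy)f(y)$ on $L_0^2(\omega)=\{f\in L^2(\omega):\int f\,d\omega=0\}$. $\bar P$ is the Mtk on $\mathcal K$ with $\bar P(k,\{k'\})=\frac{1}{\Psi_k(\mathsf Z_k)}\sum_{k''\in\mathcal K}\int_{\mathsf Z_{k''}}\Psi_{k''}(dz)P((k'',z),\{k\}\times\mathsf Z_k)P((k'',z),\{k'\}\times\mathsf Z_{k'})$; it is reversible and positive semi-definite with respect to $\bar\Pi(\{k\})=\Pi(\{k\}\times\mathsf Z_k)$. $M_P$ denotes the matrix of $\bar P$, and $\lambda_1(M_P)$ denotes $\|\bar P\|_{\bar\Pi}$, the norm of $\bar P$ on $L_0^2(\bar\Pi)$; when $\mathcal K$ is finite this is the second largest eigenvalue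 (counting multiplicity) of $M_P$. *)

(* Defs.v *)
From HB Require Import structures.
From mathcomp Require Import all_boot all_order all_algebra.
From mathcomp Require Import all_classical all_reals all_analysis.
Set Implicit Arguments. Unset Strict Implicit. Unset Printing Implicit Defensive.
Import Order.TTheory GRing.Theory Num.Theory.
Local Open Scope classical_set_scope.
Local Open Scope ring_scope.

(* k0 : K only serves to equip the carrier with a default point (required by
   mathcomp-analysis' measurable types); it plays no other role. *)
Definition sumZ (K : countType) (d : K -> measure_display)
  (Z : forall k, measurableType (d k)) (k0 : K) : Type := {k : K & Z k}.

Section sumZ_instances.
Variables (K : countType) (d : K -> measure_display)
  (Z : forall k, measurableType (d k)) (k0 : K).
HB.instance Definition _ := Choice.on (@sumZ K d Z k0).
HB.instance Definition _ := isPointed.Build (@sumZ K d Z k0)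
  (existT (fun k => Z k) k0 point).
End sumZ_instances.

Definition rectS (K : countType) (d : K -> measure_display)
  (Z : forall k, measurableType (d k)) (k0 : K) (k : K) (A : set (Z k))
  : set (sumZ Z k0) := (fun z : Z k => existT (fun k => Z k) k z : sumZ Z k0) @` A.
Arguments rectS {K d Z} k0 {k} A.

Definition rects (K : countType) (d : K -> measure_display)
  (Z : forall k, measurableType (d k)) (k0 : K) : set (set (sumZ Z k0)) :=
  [set S | exists k (A : set (Z k)), measurable A /\ S = rectS k0 A].
Arguments rects {K d Z} k0.

Definition Xsp (K : countType) (d : K -> measure_display)
  (Z : forall k, measurableType (d k)) (k0 : K) :=
  g_sigma_algebraType (rects (Z:=Z) k0).
Arguments Xsp {K d} Z k0.

Definition rect (K : countType) (d : K -> measure_display)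
  (Z : forall k, measurableType (d k)) (k0 : K) (k : K) (A : set (Z k))
  : set (Xsp Z k0) := rectS k0 A.
Arguments rect {K d Z} k0 {k} A.

Definition injX (K : countType) (d : K -> measure_display)
  (Z : forall k, measurableType (d k)) (k0 : K) (k : K) (z : Z k) : Xsp Z k0 :=
  existT (fun k => Z k) k z.
Arguments injX {K d Z} k0 {k} z.

Definition discK (K : countType) (k0 : K) : Type := K.
Section discK_instances.
Variables (K : countType) (k0 : K).
HB.instance Definition _ := Choice.on (discK k0).
HB.instance Definition _ := isPointed.Build (discK k0) k0.
HB.instance Definition _ := @isMeasurable.Build default_measure_display
  (discK k0) [set: set (discK k0)] I (fun _ _ => I) (fun _ _ => I).
End discK_instances.

Definition kop d (T : measurableType d) (R : realType) (P : R.-ker T ~> T)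
  (f : T -> R) : T -> R :=
  fun x => fine (\int[P x]_y (f y)%:E)%E.

Definition opnorm d (T : measurableType d) (R : realType)
  (w : {measure set T -> \bar R}) (Op : (T -> R) -> (T -> R)) : \bar R :=
  ereal_sup ((fun f : T -> R => 'N[w]_(2%:E)[EFin \o Op f])%E @`
    [set f : T -> R | [/\ measurable_fun [set: T] f,
                          ('N[w]_(2%:E)[EFin \o f] <= 1)%E &
                          (\int[w]_x (f x)%:E = 0)%E]]).

Definition Pbar (K : countType) (d : K -> measure_display)
  (Z : forall k, measurableType (d k)) (k0 : K) (R : realType)
  (Psi : forall k, {measure set (Z k) -> \bar R})
  (P : R.-ker (Xsp Z k0) ~> (Xsp Z k0)) (k k' : K) : R :=
  (fine (Psi k [set: Z k]))^-1 *
  fine (\int[@counting (discK k0) R]_k''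
          \int[Psi k'']_z (P (injX k0 z) (rect k0 [set: Z k]) *
                            P (injX k0 z) (rect k0 [set: Z k'])))%E.

Definition Pbar_op (K : countType) (d : K -> measure_display)
  (Z : forall k, measurableType (d k)) (k0 : K) (R : realType)
  (Psi : forall k, {measure set (Z k) -> \bar R})
  (P : R.-ker (Xsp Z k0) ~> (Xsp Z k0)) (g : discK k0 -> R) : discK k0 -> R :=
  fun k => fine (\int[@counting (discK k0) R]_k'
                    (Pbar Psi P k k' * g k')%:E)%E.

(* Main.v *)
(** Write [S = P^t], let [E] be the orthogonal projection of L^2(Pi) onto the functions of the
    index [k], and let [a = C^2 (1 - s)] with [C = inf c_k^t] and [s = sup ||P_k^t||^2].
    Since [S((k,z), {k} x A) >= c_k^t P_k^t(z, A)] and a variance is the infimum over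
    constants [b] of the integral of [(f - b)^2], the deficit [||f||^2 - ||S f||^2], which is the
    mean of the variances of [f] under [S(x, .)], is at least [a ||f - E f||^2].
    Moreover [Pbar = E P^* P E], so that [||S E f||^2 <= ||P E f||^2 <= lambda_1 ||E f||^2].
    With adjoints one would conclude from [||S S^* h||^2 <= (1 - a) ||S^* h||^2 + a ||E S^* h||^2]
    and [||E S^*|| = ||S E||].  Here the adjoint is avoided by evaluating the first inequality at
    a near-maximiser [f] of [||S f|| / ||f||]: the form [M <u, v> - <S u, S v>], [M = ||S||^2], is
    positive and almost vanishes at [f], so testing it against [E f] bounds [M ||E f||^2] by
    [lambda_1] up to a small error. *)
Require Import Defs.
From HB Require Import structures.
From mathcomp Require Import all_boot all_order all_algebra.
From mathcomp Require Import all_classical all_reals all_analysis.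
From mathcomp Require Import measurable_realfun ring lra.
Set Implicit Arguments. Unset Strict Implicit. Unset Printing Implicit Defensive.
Import Order.TTheory GRing.Theory Num.Theory.
Local Open Scope classical_set_scope.
Local Open Scope ring_scope.

(** * Square-integrable functions *)

Section square_integrable.
Context d (T : measurableType d) (R : realType).
Variable w : {measure set T -> \bar R}.
Implicit Types f g h : T -> R.

Definition L2 f :=
  measurable_fun [set: T] f /\ w.-integrable setT (EFin \o (fun x => f x ^+ 2)).

Definition ip f g : R := \int[w]_x (f x * g x).

Lemma L2P f : measurable_fun [set: T] f ->
  (\int[w]_x (f x ^+ 2)%:E < +oo)%E -> L2 f.
Proof.
move=> mf fy; split=> //; apply/integrableP; split.
  exact/measurable_EFinP/measurable_funX.
by under eq_integral do rewrite /= ger0_norm ?sqr_ge0//.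
Qed.

Lemma L2_lty f : L2 f -> (\int[w]_x (f x ^+ 2)%:E < +oo)%E.
Proof. by move=> [_ /integrable_lty]; exact. Qed.

Lemma ipE f : L2 f -> (ip f f)%:E = (\int[w]_x (f x ^+ 2)%:E)%E.
Proof.
move=> [_ fi]; rewrite /ip /Rintegral fineK.
  by apply: eq_integral => x _; rewrite expr2.
by under eq_fun do rewrite -expr2; exact: integrable_fin_num.
Qed.

Lemma L2_integrable_mul f g : L2 f -> L2 g ->
  w.-integrable setT (EFin \o (fun x => f x * g x)).
Proof.
move=> [mf fi] [mg gi].
apply: (le_integrable measurableT _ _ (integrableD measurableT fi gi)) => //.
  exact/measurable_EFinP/measurable_funM.
move=> x _ /=; rewrite lee_fin normrM [leRHS]ger0_norm ?addr_ge0 ?sqr_ge0//.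
rewrite -(real_normK (num_real (f x))) -(real_normK (num_real (g x))).
move: (normr_ge0 (f x)) (normr_ge0 (g x)) (sqr_ge0 (`|f x| - `|g x|)).
by move: `|f x| `|g x| => a b; nra.
Qed.

Lemma L2D f g : L2 f -> L2 g -> L2 (fun x => f x + g x).
Proof.
move=> Lf Lg; have fg := L2_integrable_mul Lf Lg.
move: Lf Lg => [mf fi] [mg gi].
split; first exact: measurable_funD.
have := integrableD measurableT (integrableD measurableT fi gi)
  (integrableZl measurableT 2 fg).
apply: eq_integrable => // x _ /=; rewrite -EFinM -!EFinD; congr EFin; ring.
Qed.

Lemma L2Z c f : L2 f -> L2 (fun x => c * f x).
Proof.
move=> [mf fi]; split; first exact: measurable_funM.
have := integrableZl measurableT (c ^+ 2) fi.
by apply: eq_integrable => // x _ /=; rewrite -EFinM exprMn.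
Qed.

Lemma L2B f g : L2 f -> L2 g -> L2 (fun x => f x - g x).
Proof.
move=> Lf Lg; have := L2D Lf (L2Z (-1) Lg).
by under eq_fun do rewrite mulN1r.
Qed.

Lemma ipC f g : ip f g = ip g f.
Proof. by apply: eq_Rintegral => x _; rewrite mulrC. Qed.

Lemma ipDl f g h : L2 f -> L2 g -> L2 h ->
  ip (fun x => f x + g x) h = ip f h + ip g h.
Proof.
move=> Lf Lg Lh; rewrite /ip -RintegralD//; try exact: L2_integrable_mul.
by apply: eq_Rintegral => x _; rewrite mulrDl.
Qed.

Lemma ipZl c f h : L2 f -> L2 h -> ip (fun x => c * f x) h = c * ip f h.
Proof.
move=> Lf Lh; rewrite /ip -RintegralZl//; try exact: L2_integrable_mul.
by apply: eq_Rintegral => x _; rewrite mulrA.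
Qed.

Lemma ip_ge0 f : 0 <= ip f f.
Proof. by apply: Rintegral_ge0 => x _; rewrite -expr2 sqr_ge0. Qed.

Lemma ip_bilinear t a b c e : L2 a -> L2 b -> L2 c -> L2 e ->
  ip (fun x => a x + t * b x) (fun x => c x + t * e x) =
  ip a c + t * ip a e + t * ip b c + t ^+ 2 * ip b e.
Proof.
move=> La Lb Lc Le; have Lte := L2Z t Le; have Ltb := L2Z t Lb.
have LD := L2D Lc Lte.
have ipr u : L2 u -> ip u (fun x => c x + t * e x) = ip u c + t * ip u e.
  by move=> Lu; rewrite ipC ipDl// ipZl// (ipC c) (ipC e).
by rewrite ipDl// ipZl// !ipr//; ring.
Qed.

Lemma ip_DZ t f g : L2 f -> L2 g ->
  ip (fun x => f x + t * g x) (fun x => f x + t * g x) =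
  ip f f + 2 * t * ip f g + t ^+ 2 * ip g g.
Proof. by move=> Lf Lg; rewrite ip_bilinear// [ip g f]ipC; ring. Qed.

(** Kernel averages are controlled only up to null sets, so membership in L^2, integrals and inner
    products must be transported along a.e. equality, here and in [ae_eq_Rintegral] and [ae_ip]. *)
Lemma ae_L2 f g : measurable_fun [set: T] g -> L2 f ->
  {ae w, forall x, f x = g x} -> L2 g.
Proof.
move=> mg Lf fg; apply: L2P => //; rewrite (le_lt_trans _ (L2_lty Lf))//.
rewrite le_eqVlt; apply/orP; left; apply/eqP/ae_eq_integral => //.
- exact/measurable_EFinP/measurable_funX.
- by apply/measurable_EFinP/measurable_funX; case: Lf.
- by apply: filterS fg => x /= ->.
Qed.

Lemma ae_eq_Rintegral f g : measurable_fun [set: T] f ->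
  measurable_fun [set: T] g ->
  {ae w, forall x, f x = g x} -> \int[w]_x f x = \int[w]_x g x.
Proof.
move=> mf mg fg; congr fine; apply: ae_eq_integral => //.
- exact/measurable_EFinP.
- exact/measurable_EFinP.
- by apply: filterS fg => x /= ->.
Qed.

Lemma ae_ip f f' g g' : measurable_fun [set: T] f ->
  measurable_fun [set: T] f' -> measurable_fun [set: T] g ->
  measurable_fun [set: T] g' ->
  {ae w, forall x, f x = f' x} -> {ae w, forall x, g x = g' x} ->
  ip f g = ip f' g'.
Proof.
move=> mf mf' mg mg' ff' gg'; apply: ae_eq_Rintegral.
- exact: measurable_funM.
- exact: measurable_funM.
- by apply: filterS2 ff' gg' => x -> ->.
Qed.

Lemma ae_Rintegral_ge0 f : measurable_fun [set: T] f ->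
  {ae w, forall x, 0 <= f x} -> 0 <= \int[w]_x f x.
Proof.
move=> mf f0; rewrite (@ae_eq_Rintegral f (fun x => `|f x|))//.
- exact: Rintegral_ge0.
- exact: measurableT_comp.
- by apply: filterS f0 => x f0; rewrite ger0_norm.
Qed.

Lemma ae_le_Rintegral f g : w.-integrable setT (EFin \o f) ->
  w.-integrable setT (EFin \o g) -> {ae w, forall x, f x <= g x} ->
  \int[w]_x f x <= \int[w]_x g x.
Proof.
move=> fi gi fg; rewrite -subr_ge0 -RintegralB//.
apply: ae_Rintegral_ge0.
  by apply: measurable_funB; apply/measurable_EFinP;
    [exact: (measurable_int _ gi)|exact: (measurable_int _ fi)].
by apply: filterS fg => x; rewrite subr_ge0.
Qed.

Hypothesis w1 : w [set: T] = 1%E.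

Lemma L2_cst c : L2 (fun=> c).
Proof.
apply: L2P => //; rewrite (integral_cst _ measurableT (c ^+ 2)%:E).
by rewrite w1 mule1 ltry.
Qed.

Lemma Rintegral_ip1 f : \int[w]_x f x = ip f (fun=> 1).
Proof. by apply: eq_Rintegral => x _; rewrite mulr1. Qed.

Lemma L2_integrable f : L2 f -> w.-integrable setT (EFin \o f).
Proof.
move=> Lf; have := L2_integrable_mul Lf (L2_cst 1).
by apply: eq_integrable => // x _ /=; rewrite mulr1.
Qed.

Lemma ip11 : ip (fun=> 1) (fun=> 1) = 1.
Proof. by rewrite /ip Rintegral_cst// w1 mulr1 mulr1. Qed.

Lemma ip_sub_cst c f : L2 f ->
  ip (fun x => f x - c) (fun x => f x - c) =
  ip f f - 2 * c * \int[w]_x f x + c ^+ 2.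
Proof.
move=> Lf; have := ip_DZ (- c) Lf (L2_cst 1).
rewrite ip11 -Rintegral_ip1 => h.
transitivity (ip (fun x => f x + - c * 1) (fun x => f x + - c * 1)).
  by congr ip; apply/funext => x; rewrite mulr1.
by rewrite h; ring.
Qed.

Lemma sqr_Rintegral_le f : L2 f -> (\int[w]_x f x) ^+ 2 <= ip f f.
Proof.
move=> Lf; have := ip_ge0 (fun x => f x - \int[w]_y f y).
by rewrite ip_sub_cst// => h; rewrite -subr_ge0; move: h; congr (0 <= _); ring.
Qed.

End square_integrable.

(** For [C > 0] the minimiser [- B / C] gives the bound; for [C <= 0] suitable values of [t] force
    first [B = 0] and then [C = 0]. *)
Lemma quad_discr (R : realType) (A B C : R) :
  (forall t, 0 <= A + 2 * t * B + t ^+ 2 * C) -> B ^+ 2 <= A * C.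
Proof.
move=> h; have A0 : 0 <= A by have := h 0; rewrite mulr0 mul0r expr0n/= mul0r !addr0.
have [C0|C0] := leP C 0.
  have B0 : B = 0.
    apply/eqP/negP => /negP B0.
    (* At this [t] the linear term is [- (A + 1)] and the quadratic term is at most 0, so the sum is
       at most -1. *)
    have := h (- (A + 1) / (2 * B)).
    have -> : 2 * (- (A + 1) / (2 * B)) * B = - (A + 1) by field.
    have : (- (A + 1) / (2 * B)) ^+ 2 * C <= 0 by rewrite mulr_ge0_le0// sqr_ge0.
    lra.
  have [->|C0'] := eqVneq C 0; first by rewrite B0 expr0n mulr0.
  have {}C0 : C < 0 by rewrite lt_neqAle C0' C0.
  have := h ((A + 1) / - C + 1); rewrite B0 mulr0 addr0 => h1.
  exfalso.
  have u0 : 0 <= (A + 1) / - C by rewrite divr_ge0 ?addr_ge0// oppr_ge0 ltW.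
  have uE : (A + 1) / - C * C = - (A + 1) by field; lra.
  by move: ((A + 1) / - C) u0 uE h1 => u u0 uE; nra.
have := h (- B / C).
have -> : A + 2 * (- B / C) * B + (- B / C) ^+ 2 * C = (A * C - B ^+ 2) / C.
  by field; lra.
by rewrite pmulr_lge0 ?invr_gt0// subr_ge0.
Qed.

Lemma ip_cauchy_schwarz d (T : measurableType d) (R : realType)
  (w : {measure set T -> \bar R}) (f g : T -> R) : L2 w f -> L2 w g ->
  ip w f g ^+ 2 <= ip w f f * ip w g g.
Proof. by move=> Lf Lg; apply: quad_discr => t; rewrite -ip_DZ// ip_ge0. Qed.

(** * Averages under a Markov kernel *)

(* [kint P f x] is a junk value where [f] is not [P x]-integrable; for square-integrable [f] this
   happens only on a null set ([ae_ker_L2]), and identities between such averages hold a.e. *)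
Definition kint d d' (X : measurableType d) (Y : measurableType d')
  (R : realType) (P : R.-ker X ~> Y) (f : Y -> R) : X -> R :=
  fun x => \int[P x]_y f y.

(** The relation [w P = v], tested on nonnegative functions so that no integrability is involved.
    Separate source and target let it express invariance, mixtures of measures and images under maps
    alike. *)
Definition kinv d d' (X : measurableType d) (Y : measurableType d')
  (R : realType) (w : {measure set X -> \bar R}) (P : R.-ker X ~> Y)
  (v : {measure set Y -> \bar R}) := forall h : Y -> \bar R,
  measurable_fun [set: Y] h -> (forall y, 0 <= h y)%E ->
  (\int[w]_x \int[P x]_y h y = \int[v]_y h y)%E.

Section kernel_average.
Context d d' (X : measurableType d) (Y : measurableType d') (R : realType).
Variables (P : R.-ker X ~> Y).

Lemma measurable_integral_ker (h : Y -> \bar R) :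
  measurable_fun [set: Y] h -> (forall y, 0 <= h y)%E ->
  measurable_fun [set: X] (fun x => \int[P x]_y h y)%E.
Proof.
move=> mh h0; apply: measurable_fun_integral_kernel => // U mU.
exact: measurable_kernel.
Qed.

Lemma measurable_kint (f : Y -> R) : measurable_fun [set: Y] f ->
  measurable_fun [set: X] (kint P f).
Proof.
move=> mf; have mEf : measurable_fun [set: Y] (EFin \o f) by exact/measurable_EFinP.
apply: measurableT_comp => //.
under eq_fun do rewrite integralE.
apply: emeasurable_funB; apply: measurable_integral_ker => //.
- exact: measurable_funepos.
- exact: measurable_funeneg.
Qed.

Variables (w : {measure set X -> \bar R}) (v : {measure set Y -> \bar R}).
Hypothesis wPv : kinv w P v.

Lemma ae_ker_lty (h : Y -> \bar R) : measurable_fun [set: Y] h ->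
  (forall y, 0 <= h y)%E -> (\int[v]_y h y < +oo)%E ->
  {ae w, forall x, (\int[P x]_y h y < +oo)%E}.
Proof.
move=> mh h0 hy.
have hi : w.-integrable setT (fun x => \int[P x]_y h y)%E.
  apply/integrableP; split; first exact: measurable_integral_ker.
  under eq_integral do rewrite gee0_abs ?integral_ge0//.
  by rewrite wPv.
apply: filterS (integrable_ae measurableT hi) => x /(_ I).
by move=> /fin_numPlt/andP[].
Qed.

Lemma ae_ker_integrable (f : Y -> R) : v.-integrable setT (EFin \o f) ->
  {ae w, forall x, (P x).-integrable setT (EFin \o f)}.
Proof.
move=> /integrableP[mf fy].
have mab : measurable_fun [set: Y] (fun y => `|(EFin \o f) y|%E).
  exact: measurableT_comp.
have := ae_ker_lty mab (fun=> abse_ge0 _) fy.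
by apply: filterS => x Pxy; apply/integrableP; split.
Qed.

Lemma ae_ker_L2 (f : Y -> R) : L2 v f -> {ae w, forall x, L2 (P x) f}.
Proof.
move=> [mf fi]; apply: filterS (ae_ker_integrable fi) => x Pxi.
by split.
Qed.

(** Tonelli for the positive and negative parts; [kint P f] is the difference of their averages
    wherever [f] is [P x]-integrable, which is almost everywhere. *)
Lemma kint_integrable (f : Y -> R) : v.-integrable setT (EFin \o f) ->
  w.-integrable setT (EFin \o kint P f) /\ \int[w]_x kint P f x = \int[v]_y f y.
Proof.
move=> fi; have mEf := measurable_int _ fi.
have mf : measurable_fun [set: Y] f by exact/measurable_EFinP.
have mp : measurable_fun [set: Y] (EFin \o f)^\+%E by exact: measurable_funepos.
have mn : measurable_fun [set: Y] (EFin \o f)^\-%E by exact: measurable_funeneg.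
pose up x := (\int[P x]_y (EFin \o f)^\+ y)%E.
pose un x := (\int[P x]_y (EFin \o f)^\- y)%E.
have ip : w.-integrable setT up.
  apply/integrableP; split; first exact: measurable_integral_ker.
  under eq_integral do rewrite gee0_abs ?integral_ge0//.
  by rewrite wPv//; exact: integral_funepos_lt_pinfty fi.
have im : w.-integrable setT un.
  apply/integrableP; split; first exact: measurable_integral_ker.
  under eq_integral do rewrite gee0_abs ?integral_ge0//.
  by rewrite wPv//; exact: integral_funeneg_lt_pinfty fi.
have iB := integrableB measurableT ip im.
have mk : measurable_fun [set: X] (EFin \o kint P f).
  by apply/measurable_EFinP; exact: measurable_kint.
have aeE : ae_eq w setT (EFin \o kint P f) (up \- un)%E.
  apply: filterS (ae_ker_integrable fi) => x Pxi _ /=.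
  rewrite /kint /Rintegral fineK; last exact: integrable_fin_num.
  by rewrite [LHS]integralE.
have E : (\int[w]_x (kint P f x)%:E = \int[v]_y (f y)%:E)%E.
  rewrite (@ae_eq_integral _ _ _ _ _ (up \- un)%E)//; last exact: (measurable_int _ iB).
  by rewrite integralB// [RHS]integralE !wPv.
split; last by rewrite /Rintegral E.
have mB := measurable_int _ iB.
apply/integrableP; split => //.
rewrite (@ae_eq_integral _ _ _ _ _ (abse \o (up \- un)%E))//.
- by case/integrableP : iB.
- exact: measurableT_comp.
- exact: measurableT_comp.
- by apply: filterS aeE => x /(_ I) h _; rewrite /comp -h.
Qed.

Hypothesis P1 : forall x, P x [set: Y] = 1%E.

Lemma kint_cst c : kint P (fun=> c) = (fun=> c).
Proof. by apply/funext => x; rewrite /kint Rintegral_cst// P1 mulr1. Qed.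

(** Jensen's inequality under each [P x], then integration over [w]. *)
Lemma kint_contract (f : Y -> R) : L2 v f ->
  L2 w (kint P f) /\ ip w (kint P f) (kint P f) <= ip v f f.
Proof.
move=> Lf; have [mf fi] := Lf.
have mk := measurable_kint mf.
have msq : measurable_fun [set: Y] (fun y => (f y ^+ 2)%:E).
  exact/measurable_EFinP/measurable_funX.
have sq0 y : (0 <= (f y ^+ 2)%:E)%E by rewrite lee_fin sqr_ge0.
have le : (\int[w]_x (kint P f x ^+ 2)%:E <= \int[v]_y (f y ^+ 2)%:E)%E.
  rewrite -wPv//; apply: ge0_le_integral => //.
  - by move=> x _; rewrite lee_fin sqr_ge0.
  - exact/measurable_EFinP/measurable_funX.
  - by apply: measurable_integral_ker.
  - move=> x _; have [fy|] := ltP (\int[P x]_y (f y ^+ 2)%:E)%E +oo%E.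
      have LPx : L2 (P x) f by exact: L2P.
      by rewrite -ipE// lee_fin sqr_Rintegral_le.
    (* Where [f] is not square-integrable under [P x] the right-hand side is [+oo], so the default
       value of [kint] is harmless. *)
    by rewrite leye_eq => /eqP ->; rewrite leey.
have Lk : L2 w (kint P f) by apply: L2P => //; rewrite (le_lt_trans le)// L2_lty.
by split=> //; rewrite -lee_fin !ipE.
Qed.

Lemma ae_kintDZ t (f g : Y -> R) : L2 v f -> L2 v g ->
  {ae w, forall x, kint P (fun y => f y + t * g y) x = kint P f x + t * kint P g x}.
Proof.
move=> Lf Lg; apply: filterS2 (ae_ker_L2 Lf) (ae_ker_L2 Lg) => x Lfx Lgx.
rewrite /kint RintegralD//; last 2 first.
- exact: L2_integrable.
- by apply: L2_integrable => //; exact: L2Z.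
by rewrite RintegralZl//; exact: L2_integrable.
Qed.

(** Total variance: for almost every [x] the integrand is the variance of [f] under [P x]. *)
Lemma ip_sub_kint (f : Y -> R) : L2 v f ->
  w.-integrable setT
    (EFin \o (fun x => kint P (fun y => f y ^+ 2) x - kint P f x ^+ 2)) /\
  ip v f f - ip w (kint P f) (kint P f) =
  \int[w]_x (kint P (fun y => f y ^+ 2) x - kint P f x ^+ 2).
Proof.
move=> Lf; have [[mk ik] _] := kint_contract Lf.
have [i2 E2] := kint_integrable Lf.2.
split.
  have := integrableB measurableT i2 ik.
  by apply: eq_integrable => // x _ /=.
by rewrite RintegralB// E2.
Qed.

End kernel_average.

(** For a measurable null set [N], [P x N] is nonnegative with integral [v N = 0], so it vanishes
    for almost every [x]. *)
Lemma ae_kinv d d' (X : measurableType d) (Y : measurableType d') (R : realType)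
  (w : {measure set X -> \bar R}) (P : R.-ker X ~> Y)
  (v : {measure set Y -> \bar R}) (Q : set Y) : kinv w P v ->
  {ae v, forall y, Q y} -> {ae w, forall x, {ae P x, forall y, Q y}}.
Proof.
move=> wPv [N [mN N0 QN]].
have mh : measurable_fun [set: Y] (EFin \o \1_N : Y -> \bar R).
  exact/measurable_EFinP.
have h0 y : (0 <= (EFin \o \1_N : Y -> \bar R) y)%E by rewrite lee_fin.
have : (\int[w]_x `|P x N| = 0)%E.
  rewrite -N0 -(setIT N) -integral_indic// -wPv//.
  apply: eq_integral => x _; rewrite integral_indic// setIT gee0_abs//.
move=> /ae_eq_integral_abs => /(_ measurableT (measurable_kernel P N mN)).
by apply: filterS => x /(_ I) PN0; exists N.
Qed.

(** * Operator norms and the near-maximiser argument *)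

Lemma Lnorm2_sqr d (T : measurableType d) (R : realType)
  (w : {measure set T -> \bar R}) (f : T -> R) :
  'N[w]_(2%:E)[EFin \o f]%E = ((\int[w]_x (f x ^+ 2)%:E) `^ 2^-1)%E.
Proof.
rewrite unlock; congr (_ `^ _)%E; apply: eq_integral => x _ /=.
by rewrite powR_mulrn// real_normK// num_real.
Qed.

Lemma Lnorm2_ip d (T : measurableType d) (R : realType)
  (w : {measure set T -> \bar R}) (f : T -> R) : L2 w f ->
  'N[w]_(2%:E)[EFin \o f]%E = (Num.sqrt (ip w f f))%:E.
Proof.
move=> Lf; rewrite Lnorm2_sqr -ipE// poweR_EFin.
by rewrite powR12_sqrt// ip_ge0.
Qed.

Lemma Lnorm2_le1 d (T : measurableType d) (R : realType)
  (w : {measure set T -> \bar R}) (f : T -> R) : measurable_fun [set: T] f ->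
  ('N[w]_(2%:E)[EFin \o f] <= 1)%E -> L2 w f /\ ip w f f <= 1.
Proof.
move=> mf Nf; have Lf : L2 w f.
  apply: L2P => //; apply: (@lty_poweRy _ _ 2^-1); first by rewrite invr_neq0.
  by rewrite -Lnorm2_sqr (le_lt_trans Nf)// ltry.
split=> //; move: Nf; rewrite Lnorm2_ip// lee_fin => Nf.
by rewrite -(sqr_sqrtr (ip_ge0 w f)) expr_le1// sqrtr_ge0.
Qed.

Section operator_norm.
Context d (T : measurableType d) (R : realType).
Variables (w : {measure set T -> \bar R}) (S : R.-ker T ~> T).
Variable (Op : (T -> R) -> (T -> R)).
Hypothesis w1 : w [set: T] = 1%E.
Hypothesis S1 : forall x, S x [set: T] = 1%E.
Hypothesis wS : kinv w S w.
Hypothesis mOp : forall f, L2 w f -> measurable_fun [set: T] (Op f).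
Hypothesis OpE : forall f, L2 w f -> {ae w, forall x, kint S f x = Op f x}.

(** [Op] stands for an operator of the theorem and [S] for a Markov kernel whose averages equal it
    almost everywhere; [OpE] carries properties of [kint S] over to [Op]. *)
Lemma L2_op f : L2 w f -> L2 w (Op f).
Proof.
move=> Lf; have [Lk _] := kint_contract wS S1 Lf.
exact: ae_L2 (mOp Lf) Lk (OpE Lf).
Qed.

Lemma ip_op f g : L2 w f -> L2 w g ->
  ip w (Op f) (Op g) = ip w (kint S f) (kint S g).
Proof.
move=> Lf Lg; apply/esym/ae_ip; try exact: OpE; try exact: mOp.
- by apply: measurable_kint; case: Lf.
- by apply: measurable_kint; case: Lg.
Qed.

Lemma ip_op_le f : L2 w f -> ip w (Op f) (Op f) <= ip w f f.
Proof. by move=> Lf; rewrite ip_op//; case: (kint_contract wS S1 Lf). Qed.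

Lemma ip_op_DZ t f g : L2 w f -> L2 w g ->
  ip w (Op (fun x => f x + t * g x)) (Op (fun x => f x + t * g x)) =
  ip w (Op f) (Op f) + 2 * t * ip w (Op f) (Op g) + t ^+ 2 * ip w (Op g) (Op g).
Proof.
move=> Lf Lg; have LZ := L2Z t Lg; have LD := L2D Lf LZ.
have [Lkf _] := kint_contract wS S1 Lf; have [Lkg _] := kint_contract wS S1 Lg.
rewrite !ip_op// -ip_DZ//.
have mk : measurable_fun [set: T] (kint S (fun x => f x + t * g x)).
  by apply: measurable_kint; case: LD.
have mk' : measurable_fun [set: T] (fun x => kint S f x + t * kint S g x).
  by case: (L2D Lkf (L2Z t Lkg)).
by apply: ae_ip => //; exact: (ae_kintDZ wS S1 t Lf Lg).
Qed.

Lemma opnorm_ge0 : (0 <= opnorm w Op)%E.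
Proof.
suff h : ('N[w]_(2%:E)[EFin \o Op (fun=> 0%R)]%E <= opnorm w Op)%E.
  exact: le_trans (Lnorm_ge0 _ _ _) h.
apply: ereal_sup_ubound; exists (fun=> 0) => //; split => //.
- rewrite Lnorm2_ip ?ip_ge0//; last exact: L2_cst.
  by rewrite lee_fin /ip Rintegral_cst// mulr0 mul0r sqrtr0 ler01.
- by rewrite integral0.
Qed.

Lemma opnorm_le1 : (opnorm w Op <= 1)%E.
Proof.
apply: ge_ereal_sup => _ [f [mf Nf _] <-].
have [Lf f1] := Lnorm2_le1 mf Nf.
rewrite Lnorm2_ip ?lee_fin; last exact: L2_op.
by rewrite -sqrtr1 ler_wsqrtr// (le_trans (ip_op_le Lf)).
Qed.

Lemma opnorm_fineK : ((fine (opnorm w Op))%:E = opnorm w Op)%E.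
Proof.
by rewrite fineK// ge0_fin_numE ?opnorm_ge0// (le_lt_trans opnorm_le1)// ltry.
Qed.

Lemma fine_opnorm_ge0 : 0 <= fine (opnorm w Op).
Proof. by rewrite fine_ge0// opnorm_ge0. Qed.

Lemma fine_opnorm_le1 : fine (opnorm w Op) <= 1.
Proof. by rewrite -lee_fin opnorm_fineK opnorm_le1. Qed.

(** Rescaled to norm 1, [f] competes in the supremum; if its norm is 0, contraction suffices. *)
Lemma opnorm_bound f : L2 w f -> \int[w]_x f x = 0 ->
  ip w (Op f) (Op f) <= fine (opnorm w Op) ^+ 2 * ip w f f.
Proof.
move=> Lf f0; have [ff0|ff0] := eqVneq (ip w f f) 0.
  by rewrite ff0 mulr0 -ff0 ip_op_le.
have s0 : 0 < ip w f f by rewrite lt_neqAle eq_sym ff0 ip_ge0.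
pose c := (Num.sqrt (ip w f f))^-1.
have c2 : c ^+ 2 * ip w f f = 1.
  by rewrite exprVn sqr_sqrtr ?ip_ge0// mulVf.
pose g x := c * f x.
have Lg : L2 w g by exact: L2Z.
have gg : ip w g g = 1 by rewrite ipZl// ipC ipZl// mulrA -expr2.
have g0 : (\int[w]_x (g x)%:E = 0)%E.
  rewrite -[LHS]fineK; last by apply: integrable_fin_num => //; exact: L2_integrable.
  by rewrite -/(Rintegral w setT g) RintegralZl// ?f0 ?mulr0//; exact: L2_integrable.
have : (('N[w]_(2%:E)[EFin \o Op g])%E <= opnorm w Op)%E.
  apply: ereal_sup_ubound; exists g => //; split => //; first by case: Lg.
  by rewrite Lnorm2_ip// gg sqrtr1.
have LOg := L2_op Lg; have LOf := L2_op Lf.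
rewrite Lnorm2_ip// -opnorm_fineK lee_fin => h.
(* Linearity of [Op] is known only almost everywhere, so quadratic scaling is read off [ip_op_DZ]
   with the zero function as first argument. *)
have -> : ip w (Op f) (Op f) = ip w (Op g) (Op g) * ip w f f.
  have z : L2 w (fun=> 0) by exact: L2_cst.
  have := ip_op_DZ c z Lf.
  have -> : (fun x => 0 + c * f x) = g by apply/funext => x; rewrite add0r.
  have E0 h' : L2 w h' -> ip w (Op (fun=> 0)) (Op h') = 0.
    move=> Lh; rewrite ip_op// kint_cst// /ip.
    by under eq_Rintegral do rewrite mul0r; rewrite Rintegral_cst// mul0r.
  rewrite !E0// mulr0 !add0r => ->; rewrite mulrAC c2 mul1r//.
rewrite ler_wpM2r ?ip_ge0//.
rewrite -(sqr_sqrtr (ip_ge0 w (Op g))).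
by rewrite ler_sqr// nnegrE ?sqrtr_ge0// fine_opnorm_ge0.
Qed.

Lemma opnorm_approx e : 0 < e -> exists f, [/\ L2 w f, \int[w]_x f x = 0,
  ip w f f <= 1 & fine (opnorm w Op) ^+ 2 - e <= ip w (Op f) (Op f)].
Proof.
move=> e0; have o0 := fine_opnorm_ge0; have o1 := fine_opnorm_le1.
(* Losing [e / 2] in the norm costs at most [e] in its square, because the norm is at most 1. *)
have : (opnorm w Op - (e / 2)%:E < opnorm w Op)%E.
  by rewrite -opnorm_fineK -EFinB lte_fin; lra.
move=> /ereal_sup_gt [_ [f [mf Nf f0] <-]].
have [Lf f1] := Lnorm2_le1 mf Nf; have LOf := L2_op Lf.
rewrite Lnorm2_ip// -opnorm_fineK -EFinB lte_fin => h.
exists f; split => //; first by rewrite /Rintegral f0.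
have s0 := sqrtr_ge0 (ip w (Op f) (Op f)).
rewrite -[leRHS](sqr_sqrtr (ip_ge0 w (Op f))).
have [oe|oe] := leP (fine (opnorm w Op)) (e / 2); first by nra.
have : (fine (opnorm w Op) - e / 2) ^+ 2 <= Num.sqrt (ip w (Op f) (Op f)) ^+ 2.
  by rewrite ler_sqr ?nnegrE//; lra.
by nra.
Qed.

End operator_norm.

Lemma le_of_le_eps (R : realType) (A B c : R) : 0 <= c ->
  (forall e, 0 < e -> e <= 1 -> A <= B + c * e) -> A <= B.
Proof.
move=> c0 h; rewrite leNgt; apply/negP => BA.
pose e := Num.min 1 ((A - B) / (c + 1) / 2).
have e0 : 0 < e by rewrite lt_min ltr01/= !divr_gt0// ?subr_gt0//; lra.
have e1 : e <= 1 by rewrite ge_min lexx.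
have e2 : e <= (A - B) / (c + 1) / 2 by rewrite ge_min lexx orbT.
have := h e e0 e1; move: e2; rewrite ler_pdivlMr// ler_pdivlMr; last by lra.
by nra.
Qed.

(* Read [n = ||f||^2], [x = ||S f||^2], [y = <S f, S E f>], [z = ||S E f||^2], [e = ||E f||^2]
   and [M = ||S||^2]; the last hypothesis is [||S (f + t E f)||^2 <= M ||f + t E f||^2]. *)
Lemma near_maximiser_bound (R : realType) (M lam a : R) :
  0 <= M -> M <= 1 -> 0 <= lam -> lam <= 1 -> 0 <= a -> a <= 1 ->
  (forall eps, 0 < eps -> exists n x y z e : R,
    [/\ [/\ 0 <= n, n <= 1, 0 <= e, 0 <= x & 0 <= z], M - eps <= x,
      x <= n - a * (n - e), (z <= lam * e /\ y ^+ 2 <= x * z) &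
      forall t, x + 2 * t * y + t ^+ 2 * z <= M * (n + 2 * t * e + t ^+ 2 * e)]) ->
  M ^+ 2 <= 1 - a * (1 - lam).
Proof.
move=> M0 M1 l0 l1 a0 a1 H.
(* The slack in [H] is taken to be [h ^+ 2]. The constant 4 is 3 from [u <= lam + 3 * h] plus 1 from
   [M * h ^+ 2 <= h]. *)
apply: (@le_of_le_eps _ _ _ 4) => // h h0 h1.
have h20 : 0 < h ^+ 2 by rewrite exprn_gt0.
have [n [x [y [z [e [[n0 n1 e0 x0 z0] Mx xa [zl yxz] Q]]]]]] := H _ h20.
(* Cauchy-Schwarz for the form [M <u, v> - <S u, S v>] at [f] and [E f]. *)
have D : (M * e - y) ^+ 2 <= (M * n - x) * (M * e - z).
  apply: quad_discr => t; have := Q t; lra.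
have xM : x <= M by have := Q 0; rewrite !mulr0 !mul0r expr0n/= !mul0r !addr0; nra.
(* Near-maximality makes [M * n - x] at most [h ^+ 2]; if [M * e - z] is negative, the product in
   [D] is nonpositive instead. *)
have D' : (M * e - y) ^+ 2 <= h ^+ 2 * (M * e).
  apply: (le_trans D); have [Mez|] := leP 0 (M * e - z).
    have : (M * n - x) <= h ^+ 2 by nra.
    nra.
  move=> Mez; have Mnx : 0 <= M * n - x by have := Q 0; rewrite !mulr0 !mul0r expr0n/= !mul0r !addr0; lra.
  apply: (@le_trans _ _ 0); first by rewrite mulr_ge0_le0// ltW.
  by rewrite !mulr_ge0// ltW.
have y2 : y ^+ 2 <= lam * (M * e).
  apply: (le_trans yxz); apply: (@le_trans _ _ (M * (lam * e))).
    by apply: ler_pM.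
  by rewrite mulrCA.
set u := M * e in D' y2 *.
have u0 : 0 <= u by rewrite mulr_ge0.
have ul : u <= lam + 3 * h.
  have [->|un0] := eqVneq u 0; first by lra.
  have {}u0 : 0 < u by rewrite lt_neqAle eq_sym un0.
  rewrite -(ler_pM2l u0) -(ler_pM2l h0).
  (* Young's inequality [u ^+ 2 <= (1 + h) * y ^+ 2 + (1 + h^-1) * (u - y) ^+ 2], multiplied by
     [h]. *)
  have key : h * (u * u) <= h * (1 + h) * y ^+ 2 + (h + 1) * (u - y) ^+ 2.
    have := sqr_ge0 (h * y - (u - y)); nra.
  apply: (le_trans key).
  have e1 : h * (1 + h) * y ^+ 2 <= h * (1 + h) * (lam * u).
    by rewrite ler_wpM2l// mulr_ge0; lra.
  have e2 : (h + 1) * (u - y) ^+ 2 <= (h + 1) * (h ^+ 2 * u).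
    by rewrite ler_wpM2l//; lra.
  apply: (le_trans (lerD e1 e2)).
  have -> : h * (u * (lam + 3 * h)) = h * (1 + h) * (lam * u) +
    (h + 1) * (h ^+ 2 * u) + h * h * u * (2 - lam - h) by ring.
  rewrite lerDl !mulr_ge0//; lra.
(* The lower and upper bounds on [x] are multiplied by [M], so that [e] enters only through [u]. *)
have : M * (M - h ^+ 2) <= M * (1 - a) + a * u.
  have : M * (M - h ^+ 2) <= M * (n - a * (n - e)).
    by rewrite ler_wpM2l// (le_trans Mx).
  move=> /le_trans; apply.
  have : M * (1 - a) * n <= M * (1 - a) * 1 by rewrite ler_wpM2l// mulr_ge0//; lra.
  rewrite /u; lra.
have : M * (1 - a) <= 1 - a by rewrite ler_piMl//; lra.
have : a * u <= a * (lam + 3 * h) by rewrite ler_wpM2l.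
have : a * h <= h by rewrite ler_piMl// ltW.
have : M * h ^+ 2 <= h.
  have : h ^+ 2 <= h by rewrite expr2 ler_piMl// ltW.
  have : M * h ^+ 2 <= h ^+ 2 by rewrite ler_piMl// ltW.
  lra.
lra.
Qed.

(** * Powers of a Markov kernel *)

Lemma ker_comp_ex d1 d2 d3 (X : measurableType d1) (Y : measurableType d2)
  (Z : measurableType d3) (R : realType) (S : R.-sfker X ~> Y)
  (P : R.-pker Y ~> Z) : exists Q : R.-sfker X ~> Z,
  (forall x A, Q x A = \int[S x]_y P y A)%E /\
  forall h : Z -> \bar R, measurable_fun [set: Z] h -> (forall z, 0 <= h z)%E ->
  forall x, (\int[Q x]_z h z = \int[S x]_y \int[P y]_z h z)%E.
Proof.
pose k : R.-sfker (X * Y) ~> Z := kernel.kernel_snd P.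
exists (S \; k)%E; split => // h mh h0 x.
by rewrite integral_kcomp.
Qed.

(** Viewing [w] as a kernel from a one-point space makes [w P] a composite kernel, whose integral
    formula extends the equality from sets to functions. *)
Lemma kinv_sets d1 d2 (X : measurableType d1) (Y : measurableType d2)
  (R : realType) (w : probability X R) (P : R.-pker X ~> Y)
  (v : {measure set Y -> \bar R}) :
  (forall A, measurable A -> \int[w]_x P x A = v A)%E -> kinv w P v.
Proof.
move=> wPv h mh h0.
pose l : R.-pker unit ~> X := kprobability (measurable_cst (w : pprobability X R)).
have [Q [QA Qh]] := ker_comp_ex l P.
rewrite -[LHS](Qh h mh h0 tt); apply: eq_measure_integral => A mA _.
by rewrite QA wPv.
Qed.

Section iterated_kernel.
Context d (T : measurableType d) (R : realType).
Variable P : R.-pker T ~> T.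

(** Meant for nonnegative extended-valued functions, where every integral is meaningful and no
    default value occurs. *)
Definition kiter n (h : T -> \bar R) : T -> \bar R :=
  iter n (fun g x => \int[P x]_y g y)%E h.

Lemma kiter_ge0 n h : (forall x, 0 <= h x)%E -> forall x, (0 <= kiter n h x)%E.
Proof.
by move=> h0; elim: n => [|n IH] x //=; apply: integral_ge0.
Qed.

Lemma measurable_kiter n h : measurable_fun [set: T] h ->
  (forall x, 0 <= h x)%E -> measurable_fun [set: T] (kiter n h).
Proof.
move=> mh h0; elim: n => [|n IH] //=.
by apply: measurable_integral_ker => //; exact: kiter_ge0.
Qed.

Lemma measurable_iter_kop n f : measurable_fun [set: T] f ->
  measurable_fun [set: T] (iter n (kop P) f).
Proof. by move=> mf; elim: n => //= n IH; exact: measurable_kint. Qed.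

Lemma iter_kop_contract (w : {measure set T -> \bar R}) n f : kinv w P w ->
  L2 w f -> L2 w (iter n (kop P) f) /\
  ip w (iter n (kop P) f) (iter n (kop P) f) <= ip w f f.
Proof.
move=> wP Lf; elim: n => [|n [Ln n1]] //=.
have [La a1] := kint_contract wP (prob_kernel (s:=P)) Ln.
by split => //; exact: le_trans a1 n1.
Qed.

(* The kernel of [P^n] and the [n]-fold iterate of [kop P] give only a.e. equal functions, because
   of the junk values of [kop]. *)
Lemma kernel_power n : exists S : R.-sfker T ~> T,
  [/\ forall h, measurable_fun [set: T] h -> (forall x, 0 <= h x)%E ->
        forall x, (\int[S x]_y h y)%E = kiter n h x,
      forall x, S x [set: T] = 1%E,
      forall w : {measure set T -> \bar R}, kinv w P w -> kinv w S w &
      forall w : {measure set T -> \bar R}, kinv w P w -> forall f, L2 w f ->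
        {ae w, forall x, kint S f x = iter n (kop P) f x}].
Proof.
elim: n => [|n [S [SE S1 Sw SL]]].
  pose D : R.-pker T ~> T := kdirac (@measurable_id _ T setT).
  have DE h : measurable_fun [set: T] h -> forall x, (\int[D x]_y h y)%E = h x.
    by move=> mh x; rewrite integral_dirac// diracT mul1e.
  exists D; split => //.
  - by move=> h mh h0 x; exact: DE.
  - by move=> x; exact: prob_kernel.
  - by move=> w _ h mh h0; apply: eq_integral => x _; exact: DE.
  - move=> w _ f [mf _]; apply: aeW => x.
    by rewrite /kint /Rintegral DE//; exact/measurable_EFinP.
have [Q [_ QE]] := ker_comp_ex S P.
have QE' h : measurable_fun [set: T] h -> (forall x, 0 <= h x)%E ->
    forall x, (\int[Q x]_y h y)%E = kiter n.+1 h x.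
  move=> mh h0 x; rewrite QE// SE//.
  - by rewrite /kiter iterSr.
  - exact: measurable_integral_ker.
  - by move=> y; exact: integral_ge0.
have Q1 x : Q x [set: T] = 1%E.
  rewrite -[LHS]mul1e -integral_cst// QE//.
  under eq_integral do rewrite integral_cst// prob_kernel mule1.
  by rewrite integral_cst// S1 mule1.
have Qw (w : {measure set T -> \bar R}) : kinv w P w -> kinv w Q w.
  move=> wP h mh h0; under eq_integral do rewrite QE//.
  rewrite (Sw _ wP) ?wP//; first exact: measurable_integral_ker.
  by move=> y; exact: integral_ge0.
exists Q; split => // w wP f Lf.
have [LPf _] := kint_contract wP (prob_kernel (s:=P)) Lf.
(* The induction hypothesis is applied to [kint P f], the innermost of the [n.+1] averages. For
   fixed [x] the measure [Q x] is [S x] followed by [P], so signed averages compose once [f] is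
   [Q x]-integrable. *)
apply: filterS2 (SL _ wP _ LPf) (ae_ker_L2 (Qw _ wP) Lf) => x + Lx.
rewrite [in X in _ -> X]iterSr => <-.
have SPQ : kinv (S x) P (Q x) by move=> h mh h0; rewrite QE.
by have [_ /esym] := kint_integrable SPQ (L2_integrable (Q1 x) Lx).
Qed.

End iterated_kernel.

(** * Discrete spaces and reversible matrices *)

Section discrete_space.
Context (K : countType) (k0 : K) (R : realType).
Local Notation DK := (discK k0).

Lemma measurable_discK (A : set DK) : measurable A.
Proof. exact: I. Qed.

Lemma measurable_fun_discK d (Y : measurableType d) (D : set DK) (f : DK -> Y) :
  measurable_fun D f.
Proof. by move=> ? ? ?; exact: measurable_discK. Qed.

(* Sums over [K] are turned into series over [nat] through [pickle_inv], which maps every [k]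
   from exactly one [n]; the other [n] contribute [0]. *)
Lemma integral_discK_series (mu : {measure set DK -> \bar R}) (h : DK -> \bar R) :
  (forall k, 0 <= h k)%E ->
  (\int[mu]_k h k =
   \sum_(n <oo) oapp (fun k : K => mu [set (k : DK)] * h k) 0 (pickle_inv n))%E.
Proof.
move=> h0; pose F n : set DK := [set k | pickle_inv n = Some (k : K)].
have FT : \bigcup_n F n = setT.
  by apply/seteqP; split => // k _; exists (pickle (k : K)) => //; exact: pickleK_inv.
have tF : trivIset setT F.
  apply/trivIsetP => i j _ _ ij; apply/seteqP; split => // k [/= Fi Fj].
  move: ij; have := pickle_invK (T:=K) i; have := pickle_invK (T:=K) j.
  by rewrite Fi Fj /= => -> ->; rewrite eqxx.
rewrite -FT ge0_integral_bigcup//.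
apply: eq_eseriesr => n _; case E : (pickle_inv n) => [k|] /=.
  have -> : F n = [set (k : DK)].
    by apply/seteqP; split => x /=; rewrite /F /= E; [case|move=> ->].
  rewrite (eq_integral (cst (h k))); last by move=> x /[!inE] ->.
  by rewrite integral_cst// muleC.
have -> : F n = set0 by apply/seteqP; split => x //=; rewrite /F /= E.
by rewrite integral_set0.
Qed.

Lemma counting_set1 (k : DK) : @counting DK R [set k] = 1%E.
Proof. by rewrite /counting asboolT// fset_set1 finmap.cardfs1. Qed.

Lemma integral_counting_series (h : DK -> \bar R) : (forall k, 0 <= h k)%E ->
  (\int[@counting DK R]_k h k = \sum_(n <oo) oapp h 0 (pickle_inv n))%E.
Proof.
move=> h0; rewrite integral_discK_series//; apply: eq_eseriesr => n _.
by case: (pickle_inv n) => //= k; rewrite counting_set1 mul1e.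
Qed.

Lemma integral_discK (mu : {measure set DK -> \bar R}) (h : DK -> \bar R) :
  (forall k, 0 <= h k)%E ->
  (\int[mu]_k h k = \int[@counting DK R]_k (mu [set k] * h k))%E.
Proof.
move=> h0; rewrite integral_discK_series// integral_counting_series// => k.
by rewrite mule_ge0.
Qed.

Lemma exchange_counting d (X : measurableType d) (w : {measure set X -> \bar R})
  (F : DK -> X -> \bar R) : (forall k, measurable_fun [set: X] (F k)) ->
  (forall k x, 0 <= F k x)%E ->
  (\int[@counting DK R]_k \int[w]_x F k x =
   \int[w]_x \int[@counting DK R]_k F k x)%E.
Proof.
move=> mF F0; rewrite integral_counting_series; last first.
  by move=> k; exact: integral_ge0.
under [RHS]eq_integral do rewrite integral_counting_series//.
rewrite integral_nneseries//.
- by apply: eq_eseriesr => n _; case: (pickle_inv n) => //=; rewrite integral0.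
- by move=> n; case: (pickle_inv n) => //= k; exact: mF.
- by move=> n x _; case: (pickle_inv n) => //= k; exact: F0.
Qed.

Lemma disc_pker d (Y : measurableType d) (m : DK -> {measure set Y -> \bar R}) :
  (forall k, m k [set: Y] = 1%E) ->
  exists J : R.-pker DK ~> Y, forall k, J k = m k.
Proof.
move=> m1; pose mk : isKernel _ _ _ _ R m :=
  isKernel.Build _ _ _ _ R m (fun U _ => @measurable_fun_discK _ _ _ _).
pose J0 : R.-ker DK ~> Y := HB.pack m mk.
pose pk := Kernel_isProbability.Build _ _ _ _ R J0 m1.
pose J : R.-pker DK ~> Y := HB.pack (J0 : DK -> _) J0 pk.
by exists J.
Qed.

(** Row [k] is a series of Dirac masses weighted by [q k k'] and enumerated through [pickle_inv]. *)
Lemma matrix_ker (q : K -> K -> R) : (forall k k', 0 <= q k k') ->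
  exists Q : R.-ker DK ~> DK, forall k (h : DK -> \bar R), (forall k, 0 <= h k)%E ->
   (\int[Q k]_k' h k' = \int[@counting DK R]_k' ((q k k')%:E * h k'))%E.
Proof.
move=> q0; pose m_ (k : DK) n : {measure set DK -> \bar R} :=
  oapp (fun k' : K => mscale (NngNum (q0 k k')) (dirac (k' : DK)) : {measure set DK -> \bar R})
    mzero (pickle_inv n).
pose m (k : DK) : {measure set DK -> \bar R} := mseries (m_ k) 0.
pose mk : isKernel _ _ _ _ R m :=
  isKernel.Build _ _ _ _ R m (fun U _ => @measurable_fun_discK _ _ _ _).
pose Q : R.-ker DK ~> DK := HB.pack m mk.
exists Q => k h h0; rewrite integral_counting_series; last first.
  by move=> k'; rewrite mule_ge0// lee_fin.
rewrite (@ge0_integral_measure_series _ _ _ (m_ k) setT)//.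
  apply: eq_eseriesr => n _; rewrite /m_; case: (pickle_inv n) => [k'|] /=.
    rewrite ge0_integral_mscale//.
    by rewrite integral_dirac// diracT mul1e.
  by rewrite integral_measure_zero.
Qed.

End discrete_space.

Section reversible_matrix.
Context d (X : measurableType d) (K : countType) (k0 : K) (R : realType).
Local Notation DK := (discK k0).
Variables (w : {measure set X -> \bar R}) (wb : {measure set DK -> \bar R}).
Variables (P1 : R.-ker X ~> DK) (q : K -> K -> R).
Hypothesis P1T : forall x, P1 x [set: DK] = 1%E.
Hypothesis wP1 : kinv w P1 wb.
Hypothesis wb1 : wb [set: DK] = 1%E.
Hypothesis wb0 : forall k, (0 < wb [set k])%E.
Hypothesis q0 : forall k k', 0 <= q k k'.
Hypothesis hq : forall k k' : DK,
  (wb [set k] * (q k k')%:E = \int[w]_x (P1 x [set k] * P1 x [set k']))%E.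

Let wb_fin k : wb [set k] \is a fin_num.
Proof.
rewrite ge0_fin_numE//; apply: (@le_lt_trans _ _ 1%E); last by rewrite ltry.
by rewrite -wb1; apply: le_measure; rewrite ?inE.
Qed.

Let integral_P1_set1 k : (\int[w]_x P1 x [set k] = wb [set k])%E.
Proof.
transitivity (\int[wb]_y (\1_[set k] y)%:E)%E; last by rewrite integral_indic// setIT.
rewrite -wP1//.
by apply: eq_integral => x _; rewrite integral_indic// setIT.
Qed.

(* The last item says that [Q = P1^* P1] as operators, from L^2(wb) through L^2(w). *)
Lemma reversible_matrix_ker : exists Q : R.-ker DK ~> DK,
  [/\ forall k (h : DK -> \bar R), (forall k, 0 <= h k)%E ->
        (\int[Q k]_k' h k' = \int[@counting DK R]_k' ((q k k')%:E * h k'))%E,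
      forall k, Q k [set: DK] = 1%E, kinv wb Q wb &
      forall h h' : DK -> \bar R, (forall k, 0 <= h k)%E -> (forall k, 0 <= h' k)%E ->
        (\int[wb]_k (h k * \int[Q k]_k' h' k') =
         \int[w]_x (\int[P1 x]_k h k * \int[P1 x]_k h' k))%E].
Proof.
have [Q QE] := matrix_ker k0 q0; exists Q.
(* The last item for the indicator of a point on the left: [hq] is summed against [h], and sum and
   integral are exchanged. *)
have T0 (k : DK) (h : DK -> \bar R) : (forall k, 0 <= h k)%E ->
    (wb [set k] * \int[Q k]_k' h k' =
     \int[w]_x (P1 x [set k] * \int[P1 x]_k' h k'))%E.
  move=> h0; rewrite QE// -ge0_integralZl//; last first.
    by move=> k' _; rewrite mule_ge0// lee_fin.
  rewrite (eq_integral (fun k' : DK =>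
      \int[w]_x (P1 x [set k] * P1 x [set k'] * h k'))%E); last first.
    move=> k' _; rewrite muleA hq -ge0_integralZr//.
    by apply: emeasurable_funM; exact: measurable_kernel.
  rewrite exchange_counting; last 2 first.
  - move=> k'; apply: emeasurable_funM => //.
    by apply: emeasurable_funM; exact: measurable_kernel.
  - by move=> k' x; rewrite !mule_ge0.
  apply: eq_integral => x _; rewrite [in RHS]integral_discK// -ge0_integralZl//.
  - by apply: eq_integral => k' _; rewrite muleA.
  - by move=> k' _; rewrite mule_ge0.
(* [T0] for the constant 1 shows that [wb [set k]] is unchanged by the factor [Q k [set: DK]]; it is
   positive and finite, so it cancels. *)
have Q1 k : Q k [set: DK] = 1%E.
  have := T0 k (fun=> 1%E) (fun=> lee01).
  rewrite integral_cst// mul1e.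
  under eq_integral do rewrite integral_cst// P1T !mule1.
  rewrite integral_P1_set1 -(fineK (wb_fin k)) => h.
  have wk0 : fine (wb [set k]) != 0 by rewrite gt_eqF// fine_gt0// wb0/= ltey_eq wb_fin.
  have := congr1 (fun z => (fine (wb [set k]))^-1%:E * z)%E h.
  by rewrite muleA -EFinM mulVf// mul1e.
have T1 (h h' : DK -> \bar R) : (forall k, 0 <= h k)%E -> (forall k, 0 <= h' k)%E ->
    (\int[wb]_k (h k * \int[Q k]_k' h' k') =
     \int[w]_x (\int[P1 x]_k h k * \int[P1 x]_k h' k))%E.
  move=> h0 h'0; have I0 x : (0 <= \int[P1 x]_k h' k)%E by exact: integral_ge0.
  rewrite integral_discK; last first.
    by move=> k; rewrite mule_ge0//; exact: integral_ge0.
  have mI : measurable_fun [set: X] (fun x => \int[P1 x]_k h' k)%E.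
    by apply: measurable_integral_ker => //; exact: measurable_fun_discK.
  have mP k : measurable_fun [set: X] (fun x => P1 x [set (k : DK)]).
    exact: measurable_kernel.
  rewrite (eq_integral (fun k : DK =>
      \int[w]_x (h k * (P1 x [set k] * \int[P1 x]_k' h' k')))%E); last first.
    move=> k _; rewrite muleCA T0// -ge0_integralZl//.
      by apply: emeasurable_funM.
    by move=> x _; rewrite mule_ge0.
  rewrite exchange_counting; last 2 first.
  - by move=> k; apply: measurable_funeM; apply: emeasurable_funM.
  - by move=> k x; rewrite !mule_ge0.
  apply: eq_integral => x _; rewrite [X in (X * _)%E]integral_discK//.
  rewrite -ge0_integralZr//; last by move=> k _; rewrite mule_ge0.
  by apply: eq_integral => k _; rewrite muleA [(h k * _)%E]muleC.
split => // h mh h0.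
transitivity (\int[wb]_k (1 * \int[Q k]_k' h k'))%E.
  by apply: eq_integral => k _; rewrite mul1e.
rewrite (T1 (fun=> 1%E) h)// -wP1//; apply: eq_integral => x _.
by rewrite integral_cst// P1T mule1 mul1e.
Qed.

Lemma ip_reversible_ge0 (Q : R.-ker DK ~> DK) (h h' : DK -> R) :
  (forall k, Q k [set: DK] = 1%E) -> kinv wb Q wb ->
  (forall h h' : DK -> \bar R, (forall k, 0 <= h k)%E -> (forall k, 0 <= h' k)%E ->
    (\int[wb]_k (h k * \int[Q k]_k' h' k') =
     \int[w]_x (\int[P1 x]_k h k * \int[P1 x]_k h' k))%E) ->
  (forall k, 0 <= h k) -> (forall k, 0 <= h' k) -> L2 wb h -> L2 wb h' ->
  ip wb h (kint Q h') = ip w (kint P1 h) (kint P1 h').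
Proof.
move=> Q1 wbQ T h0 h'0 Lh Lh'.
have fK (m : {measure set DK -> \bar R}) f : m.-integrable setT (EFin \o f) ->
    (\int[m]_x f x)%:E = (\int[m]_x (f x)%:E)%E.
  by move=> mf; rewrite /Rintegral fineK//; exact: integrable_fin_num.
congr fine; transitivity (\int[wb]_k ((h k)%:E * \int[Q k]_k' (h' k')%:E))%E.
  apply: ae_eq_integral => //.
  apply: filterS (ae_ker_L2 wbQ Lh') => k Lk _.
  by rewrite EFinM /kint fK//; exact: L2_integrable.
rewrite (T (EFin \o h) (EFin \o h'))//; apply: ae_eq_integral => //.
- by apply: emeasurable_funM; apply: measurable_integral_ker.
- apply/measurable_EFinP/measurable_funM; apply: measurable_kint => //.
have p1 := P1T.
apply: filterS2 (ae_ker_L2 wP1 Lh) (ae_ker_L2 wP1 Lh') => x Lx Lx' _.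
have Ex := fK _ _ (L2_integrable (p1 x) Lx).
have Ex' := fK _ _ (L2_integrable (p1 x) Lx').
by rewrite EFinM /kint Ex Ex'.
Qed.

(** Splitting [g] into positive and negative parts, both square-integrable, bilinearity reduces the
    claim to nonnegative pairs. *)
Lemma ip_reversible (Q : R.-ker DK ~> DK) (g : DK -> R) :
  (forall k, Q k [set: DK] = 1%E) -> kinv wb Q wb ->
  (forall h h' : DK -> \bar R, (forall k, 0 <= h k)%E -> (forall k, 0 <= h' k)%E ->
    (\int[wb]_k (h k * \int[Q k]_k' h' k') =
     \int[w]_x (\int[P1 x]_k h k * \int[P1 x]_k h' k))%E) -> L2 wb g ->
  ip wb g (kint Q g) = ip w (kint P1 g) (kint P1 g).
Proof.
move=> Q1 wbQ T Lg; have E h h' := @ip_reversible_ge0 Q h h' Q1 wbQ T.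
pose a k := Num.max (g k) 0; pose b k := Num.max (- g k) 0.
have a0 k : 0 <= a k by rewrite le_max lexx orbT.
have b0 k : 0 <= b k by rewrite le_max lexx orbT.
have Lle h : (forall k, 0 <= h k) -> (forall k, h k <= `|g k|) -> L2 wb h.
  move=> h0 hg; apply: L2P => //.
  apply: le_lt_trans (L2_lty Lg); apply: ge0_le_integral => //.
  - by move=> k _; rewrite lee_fin sqr_ge0.
  - move=> k _; rewrite lee_fin -(real_normK (num_real (g k))).
    by rewrite ler_sqr// nnegrE.
have La : L2 wb a by apply: Lle => // k; rewrite ge_max ler_norm normr_ge0.
have Lb : L2 wb b.
  by apply: Lle => // k; rewrite ge_max normr_ge0 -normrN ler_norm.
have gE : g = (fun k => a k + -1 * b k).
  apply/funext => k; rewrite /a /b mulN1r; case: (leP 0 (g k)) => g0.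
    by rewrite max_r ?subr0// oppr_le0.
  by rewrite max_l ?opprK ?add0r// oppr_ge0 ltW.
have p1 := P1T.
have [LQa _] := kint_contract wbQ Q1 La; have [LQb _] := kint_contract wbQ Q1 Lb.
have [LPa _] := kint_contract wP1 p1 La; have [LPb _] := kint_contract wP1 p1 Lb.
have mL d' (T' : measurableType d') (m : {measure set T' -> \bar R}) f :
  L2 m f -> measurable_fun [set: T'] f by case.
have aeQ := ae_kintDZ wbQ Q1 (-1) La Lb; have aeP := ae_kintDZ wP1 p1 (-1) La Lb.
rewrite -gE in aeQ aeP.
have mQ := mL _ _ _ _ (L2D LQa (L2Z (-1) LQb)).
have mP := mL _ _ _ _ (L2D LPa (L2Z (-1) LPb)).
have mkP : measurable_fun setT (kint P1 g) by exact: measurable_kint.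
rewrite (ae_ip mkP mP mkP mP aeP aeP).
have mkQ : measurable_fun setT (kint Q g) by exact: measurable_kint.
have mg : measurable_fun setT g by [].
rewrite (ae_ip mg mg mkQ mQ (aeW _ (fun=> erefl)) aeQ) gE.
by rewrite !ip_bilinear// !E.
Qed.

End reversible_matrix.

(** * Disintegration of the disjoint union *)

Section disjoint_union.
Context (K : countType) (k0 : K) (d : K -> measure_display)
  (Z : forall k, measurableType (d k)) (R : realType).
Local Notation DK := (discK k0).
Local Notation X := (Xsp Z k0).

Lemma measurable_rect k (A : set (Z k)) : measurable A ->
  measurable (rect k0 A : set X).
Proof. by move=> mA; apply: sub_sigma_algebra; exists k, A. Qed.

Lemma injX_inj k (z z' : Z k) : injX k0 z = injX k0 z' -> z = z'.
Proof. exact: (@eq_from_Tagged K (fun k => Z k)). Qed.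

Lemma preimage_injX_rect k (A : set (Z k)) :
  (@injX K d Z k0 k) @^-1` (rect k0 A) = A.
Proof.
apply/seteqP; split => z /=; last by move=> Az; exists z.
by move=> [z' Az' /injX_inj <-].
Qed.

Lemma preimage_injX_rect_neq k k' (A : set (Z k')) : k <> k' ->
  (@injX K d Z k0 k) @^-1` (rect k0 A) = set0.
Proof.
move=> kk'; apply/seteqP; split => z //= [z' _ zz'].
by apply: kk'; exact: (esym (congr1 (fun x => projT1 x) zz')).
Qed.

Lemma measurable_injX k : measurable_fun [set: Z k] (@injX K d Z k0 k).
Proof.
apply: (@measurability _ _ (Z k) X setT (@injX K d Z k0 k) (@rects K d Z k0)) => // _ [_ [k' [A [mA ->]] <-]].
rewrite setTI; have [kk'|kk'] := pselect (k = k').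
  by subst k'; rewrite -/(rect k0 A) preimage_injX_rect.
by rewrite -/(rect k0 A) preimage_injX_rect_neq.
Qed.

Definition projX (x : X) : DK := projT1 x.

Lemma preimage_projX (k : DK) : projX @^-1` [set k] = rect k0 [set: Z k].
Proof.
apply/seteqP; split => -[j z] /=; first by rewrite /projX /= => kj; subst k; exists z.
by move=> [z' _ h]; exact: (esym (congr1 (fun x => projT1 x) h)).
Qed.

(** Countability of [K] makes the preimage of an arbitrary subset a countable union of blocks. *)
Lemma measurable_projX : measurable_fun [set: X] projX.
Proof.
move=> _ B _; rewrite setTI.
have -> : projX @^-1` B = \bigcup_n
    (if pickle_inv n is Some k then
      (if `[< B k >] then rect k0 [set: Z k] else set0) else set0).
  apply/seteqP; split => x /=.
    move=> Bx; exists (pickle (projX x : K)) => //.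
    rewrite pickleK_inv asboolT// -preimage_projX//.
  move=> [n _]; case: (pickle_inv n) => // k; case: asboolP => // Bk.
  by rewrite -(preimage_projX k) => /= ->.
apply: bigcupT_measurable => n; case: (pickle_inv n) => // k.
by case: asboolP => // _; exact: measurable_rect.
Qed.

(** Rectangles thus form a pi-system, on which measures can be identified; over different indices
    the intersection is an empty rectangle. *)
Lemma setI_closed_rects : setI_closed (@rects K d Z k0).
Proof.
move=> _ _ [k [A [mA ->]]] [k' [B [mB ->]]].
have [kk'|kk'] := pselect (k = k').
  subst k'; exists k, (A `&` B); split; first exact: measurableI.
  apply/seteqP; split => x /=.
    by move=> [[z Az <-] [z' Bz' /injX_inj zz']]; subst z'; exists z.
  by move=> [z [Az Bz] <-]; split; exists z.
exists k, set0; split => //; apply/seteqP; split => x /=; last by move=> [].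
by move=> [[z Az <-] [z' Bz' h]]; exfalso; apply: kk'; exact: (esym (congr1 (fun x => projT1 x) h)).
Qed.

Variables (Phi : forall k, probability (Z k) R) (Pi : probability X R)
  (Pb : probability DK R).
Hypothesis PiE : forall k (A : set (Z k)), measurable A ->
  Pi (rect k0 A) = (Pb [set (k : DK)] * Phi k A)%E.

(** [J k] is the image of [Phi k] in the block over [k], the conditional law of [Pi] given the
    index. Averaging under [J] is the projection [E], read as a function of [k]. *)
Lemma disintegration : exists J : R.-pker DK ~> X,
  [/\ kinv Pb J Pi,
      forall k, kinv (Phi k) (kdirac (@measurable_injX k) : R.-pker Z k ~> X) (J k) &
      forall k, kinv (J k) (kdirac measurable_projX : R.-pker X ~> DK) (\d_k)].
Proof.
have exJ (k : DK) : exists m : {measure set X -> \bar R},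
    [/\ m [set: X] = 1%E,
      forall A, measurable A -> m A = Phi k ((@injX K d Z k0 k) @^-1` A) &
      forall h : X -> \bar R, measurable_fun [set: X] h ->
      (forall x, 0 <= h x)%E -> (\int[m]_x h x = \int[Phi k]_z h (injX k0 z))%E].
  pose l : R.-pker unit ~> Z k :=
    kprobability (measurable_cst (Phi k : pprobability (Z k) R)).
  have [Q [QA Qh]] := ker_comp_ex l
    (kdirac (@measurable_injX k) : R.-pker Z k ~> X).
  have QA' A : measurable A -> Q tt A = Phi k ((@injX K d Z k0 k) @^-1` A).
    move=> mA; have mB : measurable ((@injX K d Z k0 k) @^-1` A).
      by rewrite -[X in measurable X]setTI; exact: measurable_injX.
    transitivity (\int[Phi k]_z (\1_((@injX K d Z k0 k) @^-1` A) z)%:E)%E.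
      by rewrite QA; apply: eq_integral.
    by rewrite integral_indic// setIT.
  exists (Q tt); split => //.
    by rewrite QA'// preimage_setT probability_setT.
  move=> h mh h0; rewrite Qh//; apply: eq_integral => z _.
  by rewrite integral_dirac// diracT mul1e.
have [m mE] := choice exJ.
have m1 k : m k [set: X] = 1%E by case: (mE k).
have [J JE] := disc_pker m1.
exists J.
split.
- apply: kinv_sets => A mA.
  pose l : R.-pker unit ~> DK :=
    kprobability (measurable_cst (Pb : pprobability DK R)).
  have [Q [QA Qh]] := ker_comp_ex l J.
  (* Uniqueness of measures asks for a sequence of rectangles of finite mass covering the space;
     numbers that encode no [k] contribute an empty one. *)
  rewrite -[LHS](QA tt); pose g n : set X :=
    if pickle_inv n is Some k then rect k0 [set: Z k] else rect k0 (set0 : set (Z k0)).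
  apply: (@measure_unique _ R X (@rects K d Z k0) g _ _ _ _ (Q tt) Pi) => //.
  + exact: setI_closed_rects.
  + move=> n; rewrite /g; case: (pickle_inv n) => [k|]; first by exists k, setT.
    by exists k0, set0.
  + apply/seteqP; split => // x _; exists (pickle (projX x : K)) => //.
    by rewrite /g pickleK_inv -preimage_projX.
  + move=> _ [k [B [mB ->]]]; change (Q tt (rect k0 B) = Pi (rect k0 B)).
    rewrite PiE// QA.
    rewrite /= -[RHS]muleC; transitivity (\int[Pb]_(j in [set (k : DK)]) (cst (Phi k B) j))%E.
      rewrite [RHS]integral_mkcond; apply: eq_integral => j _.
      have [_ mj _] := mE j; rewrite JE (mj _ (measurable_rect mB)) patchE; case: ifPn => [/[!inE] ->|jk].
        by rewrite preimage_injX_rect.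
      rewrite preimage_injX_rect_neq ?measure0// => jk'.
      by move/negP: jk; apply; rewrite inE /= jk'.
    by rewrite integral_cst.
  + move=> n; rewrite QA; apply: (@le_lt_trans _ _ 1%E); last by rewrite ltry.
    rewrite -[leRHS]mule1 -(@probability_setT _ _ _ Pb) -integral_cst//.
    apply: ge0_le_integral => //.
    move=> k _; rewrite /= probability_setT JE -[leRHS](m1 k).
    apply: le_measure; rewrite ?inE// /g.
    by case: (pickle_inv n) => [j|]; exact: measurable_rect.
- move=> k h mh h0; have [_ _ mk] := mE k; rewrite JE mk//.
  by apply: eq_integral => z _; rewrite integral_dirac// diracT mul1e.
- move=> k h mh h0; have [_ _ mk] := mE k; rewrite JE mk.
  + rewrite [RHS]integral_dirac// diracT mul1e.
    transitivity (\int[Phi k]_z cst (h k) z)%E; last first.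
      by rewrite integral_cst// -[RHS]mule1; congr (_ * _)%E; exact: probability_setT.
    by apply: eq_integral => z _; rewrite [LHS]integral_dirac// diracT mul1e.
  + exact: measurable_integral_ker.
  + by move=> x; exact: integral_ge0.
Qed.

End disjoint_union.

(** * Comparison of variances *)

Lemma kint_kdirac d d' (X : measurableType d) (Y : measurableType d')
  (R : realType) (f : X -> Y) (mf : measurable_fun [set: X] f) (g : Y -> R) :
  measurable_fun [set: Y] g -> kint (kdirac mf : R.-pker X ~> Y) g = g \o f.
Proof.
move=> mg; apply/funext => x; rewrite /kint /Rintegral integral_dirac//.
  by rewrite diracT mul1e.
exact/measurable_EFinP.
Qed.

Lemma ae_kdirac d d' (X : measurableType d) (Y : measurableType d')
  (R : realType) (f : X -> Y) (mf : measurable_fun [set: X] f)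
  (w : {measure set X -> \bar R}) (v : {measure set Y -> \bar R}) (Q : set Y) :
  kinv w (kdirac mf : R.-pker X ~> Y) v ->
  {ae v, forall y, Q y} -> {ae w, forall x, Q (f x)}.
Proof.
move=> wv /(ae_kinv wv); apply: filterS => x [N [mN N0 QN]].
apply: contrapT => nQ; have : (\d_(f x) N : \bar R)%E = 0%E by exact: N0.
by rewrite diracE mem_set; [move=> /eqP; rewrite onee_eq0|exact: QN].
Qed.

Section variance_comparison.
Context dX dY (X : measurableType dX) (Y : measurableType dY) (R : realType)
  (d : Y -> measure_display) (Z : forall y, measurableType (d y)).
Variables (inj : forall y, Z y -> X)
  (minj : forall y, measurable_fun [set: Z y] (@inj y)).
Variables (w : {measure set X -> \bar R}) (v : {measure set Y -> \bar R})
  (Phi : forall y, {measure set (Z y) -> \bar R}).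
Variables (J : R.-ker Y ~> X) (S : R.-ker X ~> X)
  (T : forall y, R.-ker (Z y) ~> (Z y)) (c s : Y -> R) (a : R).
Hypothesis vJ : kinv v J w.
Hypothesis J1 : forall y, J y [set: X] = 1%E.
Hypothesis PhiJ : forall y,
  kinv (Phi y) (kdirac (@minj y) : R.-pker Z y ~> X) (J y).
Hypothesis Phi1 : forall y, Phi y [set: Z y] = 1%E.
Hypothesis S1 : forall x, S x [set: X] = 1%E.
Hypothesis wS : kinv w S w.
Hypothesis T1 : forall y z, T y z [set: Z y] = 1%E.
Hypothesis PhiT : forall y, kinv (Phi y) (T y) (Phi y).
Hypothesis c0 : forall y, 0 < c y.
Hypothesis minorization : forall y (z : Z y) (h : X -> \bar R),
  measurable_fun [set: X] h -> (forall x, 0 <= h x)%E ->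
  ((c y)%:E * \int[T y z]_u h (inj u) <= \int[S (inj z)]_x h x)%E.
Hypothesis local_gap : forall y (h : Z y -> R), L2 (Phi y) h ->
  \int[Phi y]_z h z = 0 ->
  ip (Phi y) (kint (T y) h) (kint (T y) h) <= s y * ip (Phi y) h h.
Hypothesis a_le : forall y, a <= c y * (1 - s y).

(* The variance is the minimum over [b] of the mean of [(f - b)^2], so minorization of the kernels
   passes to the variances with a single factor [c]. *)
Lemma pointwise_variance (f : X -> R) (m : R) y (z : Z y) :
  measurable_fun [set: X] f -> L2 (S (inj z)) f ->
  c y * (kint (T y) (fun u => (f (inj u) - m) ^+ 2) z -
         kint (T y) (fun u => f (inj u) - m) z ^+ 2) <=
  kint S (fun x => f x ^+ 2) (inj z) - kint S f (inj z) ^+ 2.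
Proof.
move=> mf Lf; pose h (u : Z y) := f (inj u) - m.
rewrite -[X in _ * (kint _ (fun u => X u ^+ 2) _ - _)]/h -[X in _ * (_ - kint _ X _ ^+ 2)]/h.
have mfi : measurable_fun [set: Z y] (f \o @inj y).
  exact: measurableT_comp.
pose b := kint S f (inj z).
have bound (e : R) : ((c y)%:E * \int[T y z]_u ((f (inj u) - e) ^+ 2)%:E <=
    \int[S (inj z)]_x ((f x - e) ^+ 2)%:E)%E.
  apply: (minorization z (h := fun x => ((f x - e) ^+ 2)%:E)).
    exact/measurable_EFinP/measurable_funX/measurable_funB.
  by move=> x; rewrite lee_fin sqr_ge0.
(* A finite integral under [S (inj z)] and [c y > 0] force a finite integral under [T y z]. *)
have LT e : L2 (T y z) (fun u => f (inj u) - e).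
  apply: L2P; first exact: measurable_funB.
  have := le_lt_trans (bound e) (L2_lty (L2B Lf (L2_cst (S1 _) e))).
  have [//|] := ltP (\int[T y z]_u ((f (inj u) - e) ^+ 2)%:E)%E +oo%E.
  by rewrite leye_eq => /eqP ->; rewrite gt0_muley ?lte_fin// ltxx.
have Lh : L2 (T y z) h := LT m.
have -> : kint S (fun x => f x ^+ 2) (inj z) - b ^+ 2 =
    ip (S (inj z)) (fun x => f x - b) (fun x => f x - b).
  by rewrite ip_sub_cst// -/(kint S f (inj z)) -/b /kint /ip; ring.
have := bound b; rewrite -!ipE//; last exact: (L2B Lf (L2_cst (S1 _) b)).
rewrite -EFinM lee_fin; apply: le_trans; rewrite ler_pM2l//.
have -> : (fun u => f (inj u) - b) = (fun u => h u - (b - m)).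
  by apply/funext => u; rewrite /h opprB addrACA -addrA; ring.
rewrite ip_sub_cst//.
rewrite -/(kint (T y) h z); have := sqr_ge0 (kint (T y) h z - (b - m)).
have -> : kint (T y) (fun u => h u ^+ 2) z = ip (T y z) h h by [].
lra.
Qed.

(** By [ip_sub_kint] both deficits are means of variances, one under [S], the other under [J]. For
    almost every [y], [pointwise_variance] and [local_gap] compare them with factor [a]. *)
Lemma variance_comparison (f : X -> R) : L2 w f ->
  ip w (kint S f) (kint S f) <=
  ip w f f - a * (ip w f f - ip v (kint J f) (kint J f)).
Proof.
move=> Lf; have mf : measurable_fun [set: X] f by case: Lf.
have [iV EV] := ip_sub_kint wS S1 Lf.
have [iW EW] := ip_sub_kint vJ J1 Lf.
set V := (fun x => _ - _) in iV EV; set W := (fun x => _ - _) in iW EW.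
rewrite lerBrDr addrC -lerBrDr EV EW -RintegralZl//.
(* [w] is the mixture of the [J y], so a comparison for almost every [y] suffices. *)
have [iJV <-] := kint_integrable vJ iV.
apply: ae_le_Rintegral => //.
  by have := integrableZl measurableT a iW.
have aeS := ae_kinv vJ (ae_ker_L2 wS Lf).
apply: filterS3 (ae_ker_L2 vJ Lf) (ae_ker_integrable vJ iV) aeS => y Ly iVy aeSy.
have p1 := prob_kernel (s := kdirac (@minj y) : R.-pker Z y ~> X).
(* Centring at the conditional mean gives [h] mean 0, as [local_gap] demands, and makes [W y] its
   squared norm. *)
pose m := kint J f y; pose h (u : Z y) := f (inj u) - m.
have mfi : measurable_fun [set: Z y] (f \o @inj y) by exact: measurableT_comp.
have [Lfi _] := kint_contract (PhiJ y) p1 Ly; rewrite kint_kdirac// in Lfi.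
have Lh : L2 (Phi y) h by exact: L2B Lfi (L2_cst (Phi1 y) m).
have mE : \int[Phi y]_u f (inj u) = m.
  have [_] := kint_integrable (PhiJ y) (L2_integrable (J1 y) Ly).
  by rewrite kint_kdirac.
have h0 : \int[Phi y]_u h u = 0.
  have i1 := L2_integrable (Phi1 y) Lfi.
  have i2 := L2_integrable (Phi1 y) (L2_cst (Phi1 y) m).
  rewrite (RintegralB measurableT i1 i2).
  by rewrite mE Rintegral_cst// Phi1 mulr1 subrr.
have WE : W y = ip (Phi y) h h.
  rewrite ip_sub_cst// mE /W -/m.
  have [_] := kint_integrable (PhiJ y) Ly.2; rewrite kint_kdirac; last first.
    exact: measurable_funX.
  rewrite -[\int[J y]_x _]/(kint J (fun x => f x ^+ 2) y) => <-.
  have -> : \int[Phi y]_z ((fun x => f x ^+ 2) \o @inj y) z =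
    ip (Phi y) (f \o @inj y) (f \o @inj y) by [].
  by rewrite /ip /=; ring.
change (a * W y <= kint J V y); rewrite WE.
have mV : measurable_fun [set: X] V by exact/measurable_EFinP/(measurable_int _ iVy).
have [iVi] := kint_integrable (PhiJ y) iVy.
rewrite kint_kdirac// in iVi *; rewrite -/(kint J V y) => <-.
have [ih Eh] := ip_sub_kint (@PhiT y) (@T1 y) Lh.
have le1 : c y * \int[Phi y]_z (kint (T y) (fun u => h u ^+ 2) z - kint (T y) h z ^+ 2) <=
    \int[Phi y]_z (V \o @inj y) z.
  rewrite -RintegralZl//; apply: ae_le_Rintegral => //.
    by have := integrableZl measurableT (c y) ih.
  by apply: filterS (ae_kdirac (PhiJ y) aeSy) => z Lz; exact: pointwise_variance.
apply: le_trans le1; rewrite -Eh.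
have := local_gap Lh h0 => gap.
apply: (@le_trans _ _ (c y * ((1 - s y) * ip (Phi y) h h))).
  by rewrite mulrA ler_wpM2r ?ip_ge0.
by rewrite ler_pM2l//; lra.
Qed.

End variance_comparison.

(** * Minorization of integrals and of iterated kernels *)

Section minorization.
Context dX dZ (X : measurableType dX) (Z : measurableType dZ) (R : realType).
Variables (inj : Z -> X) (minj : measurable_fun [set: Z] inj).
Variables (P : R.-pker X ~> X) (T : R.-pker Z ~> Z) (c : R).
Hypothesis c0 : 0 < c.
Hypothesis PT : forall z (A : set X), measurable A ->
  (c%:E * T z (inj @^-1` A) <= P (inj z) A)%E.

(** [P (inj z)] dominates [c] times the image of [T z] under [inj] as a measure, hence also on
    nonnegative functions. *)
Lemma integral_minorization z (h : X -> \bar R) :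
  measurable_fun [set: X] h -> (forall x, 0 <= h x)%E ->
  (c%:E * \int[T z]_u h (inj u) <= \int[P (inj z)]_x h x)%E.
Proof.
move=> mh h0; have [Q [QA Qh]] := ker_comp_ex T (kdirac minj : R.-pker Z ~> X).
pose c' : {nonneg R} := NngNum (ltW c0).
have <- : (\int[mscale c' (Q z)]_x h x = c%:E * \int[T z]_u h (inj u))%E.
  rewrite ge0_integral_mscale// Qh//; congr (_ * _)%E.
  by apply: eq_integral => u _; rewrite integral_dirac// diracT mul1e.
apply: ge0_le_measure_integral => // A mA.
have mB : measurable (inj @^-1` A).
  by rewrite -[X in measurable X]setTI; exact: minj.
apply: le_trans (PT z mA); rewrite /mscale /= lee_pmul2l// le_eqVlt; apply/orP; left.
apply/eqP; transitivity (\int[T z]_u (\1_(inj @^-1` A) u)%:E)%E.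
  by rewrite QA; apply: eq_integral.
by rewrite integral_indic// setIT.
Qed.

(** Each step costs one factor [c]: the one-step bound is applied to the remaining iterate, which
    induction bounds along [inj]. *)
Lemma kiter_minorization n z (h : X -> \bar R) :
  measurable_fun [set: X] h -> (forall x, 0 <= h x)%E ->
  ((c ^+ n)%:E * kiter T n (h \o inj) z <= kiter P n h (inj z))%E.
Proof.
move=> mh h0; have mhi : measurable_fun [set: Z] (h \o inj) by exact: measurableT_comp.
elim: n z => [|n IH] z /=; first by rewrite mul1e.
have mk := measurable_kiter P n mh h0; have k0 := kiter_ge0 P n h0.
apply: le_trans (integral_minorization z mk k0).
have k0' : forall u, (0 <= kiter T n (h \o inj) u)%E by apply: kiter_ge0 => x; exact: h0.
have mk' : measurable_fun [set: Z] (kiter T n (h \o inj)).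
  by apply: measurable_kiter => // x; exact: h0.
have cn0 : (0 <= (c ^+ n)%:E)%E by rewrite lee_fin exprn_ge0// ltW.
rewrite exprS EFinM -muleA lee_pmul2l// -ge0_integralZl//.
apply: ge0_le_integral => //.
- by move=> u _; rewrite mule_ge0.
- exact: measurable_funeM.
- exact: (measurableT_comp mk).
Qed.

End minorization.

Lemma integral_EFinE d (T : measurableType d) (R : realType)
  (m : {measure set T -> \bar R}) (f : T -> R) :
  (\int[m]_x (f x)%:E =
   \int[m]_x (Num.max (f x) 0)%:E - \int[m]_x (Num.max (- f x) 0)%:E)%E.
Proof.
rewrite integralE; congr (_ - _)%E; apply: eq_integral => x _.
  by rewrite unlock /= -EFin_max.
by rewrite unlock /= -EFin_max.
Qed.

(** The equality holds at every [k] for arbitrary [g]: nonnegative entries pass inside [Num.max], so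
    both integrals have the same positive and negative parts and even their default values agree. *)
Lemma Pbar_op_kint (K : countType) (d : K -> measure_display)
  (Z : forall k, measurableType (d k)) (k0 : K) (R : realType)
  (Psi : forall k, {measure set (Z k) -> \bar R})
  (P : R.-ker (Xsp Z k0) ~> (Xsp Z k0)) (Q : R.-ker discK k0 ~> discK k0) :
  (forall k k', 0 <= Pbar Psi P k k') ->
  (forall k (h : discK k0 -> \bar R), (forall k, 0 <= h k)%E ->
    (\int[Q k]_k' h k' =
     \int[@counting (discK k0) R]_k' ((Pbar Psi P k k')%:E * h k'))%E) ->
  forall g, Pbar_op Psi P g = kint Q g.
Proof.
move=> q0 QE g; apply/funext => k; congr fine.
rewrite [LHS]integral_EFinE [RHS]integral_EFinE !QE; last 2 first.
- by move=> k'; rewrite lee_fin le_max lexx orbT.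
- by move=> k'; rewrite lee_fin le_max lexx orbT.
by congr (_ - _)%E; apply: eq_integral => k' _;
  rewrite -EFinM maxr_pMr// mulr0 ?mulrN.
Qed.

(** * Functions of the block index *)

Section block_function.
Context d (X : measurableType d) (K : countType) (k0 : K) (R : realType).
Local Notation DK := (discK k0).
Variables (w : {measure set X -> \bar R}) (v : {measure set DK -> \bar R}).
Variables (J : R.-ker DK ~> X) (p : X -> DK) (mp : measurable_fun [set: X] p).
Hypothesis vJ : kinv v J w.
Hypothesis J1 : forall k, J k [set: X] = 1%E.
Hypothesis Jp : forall k, kinv (J k) (kdirac mp : R.-pker X ~> DK) (\d_k).
Hypothesis wp : kinv w (kdirac mp : R.-pker X ~> DK) v.

Lemma ip_block (e e' : DK -> R) : L2 v e -> L2 v e' ->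
  L2 w (e \o p) /\ ip w (e \o p) (e' \o p) = ip v e e'.
Proof.
move=> Le Le'; have p1 := prob_kernel (s := kdirac mp : R.-pker X ~> DK).
have [Lep _] := kint_contract wp p1 Le; rewrite kint_kdirac// in Lep.
split => //; have [_] := kint_integrable wp (L2_integrable_mul Le Le').
by rewrite kint_kdirac.
Qed.

(** Lifting along [p] is adjoint to averaging under [J]: [J k] is carried by the fibre over [k],
    where [e \o p] is the constant [e k] and leaves the inner integral. *)
Lemma ip_proj (f : X -> R) (e : DK -> R) : L2 w f -> L2 v e ->
  ip w f (e \o p) = ip v (kint J f) e.
Proof.
move=> Lf Le; have [Lep _] := ip_block Le Le.
have fe := L2_integrable_mul Lf Lep.
have [_ Efe] := kint_integrable vJ fe; rewrite /ip -Efe.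
apply: ae_eq_Rintegral => //.
apply: filterS (ae_ker_L2 vJ Lf) => k Lk.
have aep : {ae J k, forall x, p x = k}.
  apply: (ae_kdirac (Q := [set j | j = k]) (@Jp k)).
  exists (~` [set k]); split => //.
  transitivity ((\1_[set~ k] k : R)%:E); first by [].
  by rewrite indicE memNset//= => /(_ erefl).
rewrite /kint -RintegralZr//; last exact: L2_integrable.
have mf : measurable_fun [set: X] f by case: Lf.
apply: ae_eq_Rintegral.
- by apply: measurable_funM => //; case: Lep.
- exact: measurable_funM.
- by apply: filterS aep => x /= ->.
Qed.

End block_function.

(** * The block matrix *)

Section block_matrix.
Context (R : realType) (K : countType) (k0 : K) (d : K -> measure_display)
  (Z : forall k, measurableType (d k)).
Local Notation DK := (discK k0).
Local Notation X := (Xsp Z k0).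
Variables (Psi : forall k, {finite_measure set (Z k) -> \bar R})
  (Phi : forall k, probability (Z k) R) (Pi : probability X R)
  (Pb : probability DK R) (P : R.-pker X ~> X) (tot : R).
Hypothesis tot0 : 0 < tot.
Hypothesis PsiPhi : forall k (A : set (Z k)), measurable A ->
  (Psi k A = (tot * fine (Pb [set (k : DK)]))%:E * Phi k A)%E.
Hypothesis Pb0 : forall k : DK, (0 < Pb [set k])%E.
Hypothesis PbPhi : forall h : X -> \bar R, measurable_fun [set: X] h ->
  (forall x, 0 <= h x)%E ->
  (\int[Pb]_k \int[Phi (k : K)]_z h (injX k0 z) = \int[Pi]_x h x)%E.

Let Pb_fin (k : DK) : Pb [set k] \is a fin_num.
Proof. exact: fin_num_measure. Qed.

Lemma Pbar_ge0 k k' : 0 <= Pbar Psi P k k'.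
Proof.
apply: mulr_ge0; first by rewrite invr_ge0 fine_ge0.
by apply: fine_ge0; apply: integral_ge0 => j _; apply: integral_ge0 => z _;
  rewrite mule_ge0.
Qed.

(** The measures [Psi j] add up to [tot] times [Pi], and the prefactor in [Pbar] is the inverse of
    [tot] times the mass of [k]. Symmetry of the right-hand side contains detailed balance. *)
Lemma Pbar_balance (k k' : DK) : (Pb [set k] * (Pbar Psi P k k')%:E =
  \int[Pi]_x (P x (rect k0 [set: Z k]) * P x (rect k0 [set: Z k'])))%E.
Proof.
pose G x := (P x (rect k0 [set: Z k]) * P x (rect k0 [set: Z k']))%E.
have mr j : measurable (rect k0 [set: Z j] : set X) by exact: measurable_rect.
have G0 x : (0 <= G x)%E by rewrite mule_ge0.
have mG : measurable_fun [set: X] G.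
  by apply: emeasurable_funM; apply: measurable_kernel.
have mGi j : measurable_fun [set: Z j] (G \o @injX K d Z k0 j).
  by apply: measurableT_comp => //; exact: measurable_injX.
have PsiE j : (\int[Psi j]_z G (injX k0 z) =
    (tot * fine (Pb [set (j : DK)]))%:E * \int[Phi j]_z G (injX k0 z))%E.
  have q0 : 0 <= tot * fine (Pb [set (j : DK)]) by rewrite mulr_ge0 ?fine_ge0// ltW.
  rewrite -(ge0_integral_mscale _ _ (NngNum q0))//.
  by apply: eq_measure_integral => A mA _; exact: PsiPhi.
have E : (\int[@counting DK R]_j \int[Psi (j : K)]_z G (injX k0 z) =
    tot%:E * \int[Pi]_x G x)%E.
  rewrite -PbPhi// [in RHS]integral_discK; last by move=> j; exact: integral_ge0.
  rewrite -ge0_integralZl//; last first.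
  - by rewrite lee_fin ltW.
  - by move=> j _; rewrite mule_ge0//; exact: integral_ge0.
  by apply: eq_integral => j _; rewrite PsiE EFinM fineK// muleA.
(* [Pbar] is defined through [fine], so the integral must be known to be finite. *)
have G1 : (\int[Pi]_x G x)%E \is a fin_num.
  rewrite ge0_fin_numE; last exact: integral_ge0.
  apply: (@le_lt_trans _ _ (\int[Pi]_x cst 1 x)%E); last first.
    rewrite integral_cst// mul1e; apply: (@le_lt_trans _ _ 1%E); last by rewrite ltry.
    exact: probability_le1.
  apply: ge0_le_integral => // x _.
  rewrite -[leRHS]mule1 lee_pmul// -(prob_kernel (s := P) x);
    by apply: le_measure; rewrite ?inE.
have p0 : 0 < fine (Pb [set k]) by rewrite fine_gt0// Pb0/= ltey_eq Pb_fin.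
have PsiT : Psi k [set: Z k] = (tot * fine (Pb [set k]))%:E.
  by rewrite PsiPhi// -[RHS]mule1; congr (_ * _)%E; exact: probability_setT.
have -> : Pbar Psi P k k' =
    (tot * fine (Pb [set k]))^-1 * fine (tot%:E * \int[Pi]_x G x)%E.
  by congr (_^-1 * fine _); [exact: (congr1 fine PsiT)|exact: E].
rewrite -(fineK G1) -EFinM /= -{1}(fineK (Pb_fin k)) -EFinM; congr EFin.
by field; rewrite !gt_eqF.
Qed.

End block_matrix.

(** * Assembly of the estimate for [P^t] *)

Theorem mainTheorem5 (R : realType) (K : countType) (k0 : K)
  (d : K -> measure_display) (Z : forall k, measurableType (d k))
  (Psi : forall k, {finite_measure set (Z k) -> \bar R})
  (hPsi0 : forall k, (0 < Psi k [set: Z k])%E)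
  (hPsisum : (\int[@counting (discK k0) R]_k Psi k [set: Z k] < +oo)%E)
  (Phi : forall k, probability (Z k) R)
  (hPhi : forall k (A : set (Z k)), measurable A ->
     Phi k A = (fine (Psi k A) / fine (Psi k [set: Z k]))%:E)
  (Pi : probability (Xsp Z k0) R)
  (hPi : forall k (A : set (Z k)), measurable A ->
     Pi (rect k0 A) = (fine (Psi k A) /
       fine (\int[@counting (discK k0) R]_k' Psi k' [set: Z k']))%:E)
  (P : R.-pker (Xsp Z k0) ~> (Xsp Z k0))
  (hPinv : forall S : set (Xsp Z k0), measurable S -> (\int[Pi]_x P x S = Pi S)%E)
  (t : nat) (ht : (0 < t)%N)
  (Pk : forall k, R.-pker (Z k) ~> (Z k)) (c : K -> R)
  (hc : forall k, 0 < c k)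
  (hi : forall k (A : set (Z k)), measurable A ->
     (\int[Phi k]_z Pk k z A = Phi k A)%E)
  (hii : forall k, (opnorm (Phi k) (iter t (kop (Pk k))) < 1)%E)
  (hiii : forall k (z : Z k) (A : set (Z k)), measurable A ->
     ((c k)%:E * Pk k z A <= P (injX k0 z) (rect k0 A))%E)
  (Pibar : probability (discK k0) R)
  (hPibar : forall k : K, Pibar [set k] = Pi (rect k0 [set: Z k])) :
  (inf [set c k ^+ t | k in [set: K]]) ^+ 2
    * (1 - sup [set fine (opnorm (Phi k) (iter t (kop (Pk k)))) ^+ 2
                | k in [set: K]])
    * (1 - fine (opnorm Pibar (Pbar_op Psi P)))
  <= 1 - fine (opnorm Pi (iter t (kop P))) ^+ 4.
Proof.
set tot := fine (\int[@counting (discK k0) R]_k' Psi k' [set: Z k']) in hPi.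
have Psum0 : (0 <= \int[@counting (discK k0) R]_k' Psi k' [set: Z k'])%E.
  exact: integral_ge0.
have totE : (tot%:E = \int[@counting (discK k0) R]_k' Psi k' [set: Z k'])%E.
  by rewrite fineK// ge0_fin_numE.
have PsiT0 k : 0 < fine (Psi k [set: Z k]).
  by rewrite fine_gt0// hPsi0/= ltey_eq fin_num_measure.
have tot0 : 0 < tot.
  rewrite -lte_fin totE; apply: (@lt_le_trans _ _ (Psi k0 [set: Z k0])) => //.
  apply: (@le_trans _ _
    (\int[@counting (discK k0) R]_(k in [set (k0 : discK k0)]) Psi k [set: Z k])%E).
    rewrite (eq_integral (cst (Psi k0 [set: Z k0]))); last by move=> k /[!inE] ->.
    rewrite integral_cst// -[leLHS]mule1 (_ : 1%E = @counting (discK k0) R [set k0])//.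
    by apply/esym; exact: counting_set1.
  exact: ge0_subset_integral.
have PbE (k : discK k0) : Pibar [set k] = (fine (Psi k [set: Z k]) / tot)%:E.
  by rewrite hPibar hPi.
have Pb0 (k : discK k0) : (0 < Pibar [set k])%E by rewrite PbE lte_fin divr_gt0.
have PsiPhi k (A : set (Z k)) : measurable A ->
    (Psi k A = (tot * fine (Pibar [set (k : discK k0)]))%:E * Phi k A)%E.
  move=> mA; rewrite PbE hPhi// -EFinM /= -[LHS]fineK ?fin_num_measure//.
  by congr EFin; field; rewrite !gt_eqF.
have PiE k (A : set (Z k)) : measurable A ->
    Pi (rect k0 A) = (Pibar [set (k : discK k0)] * Phi k A)%E.
  move=> mA; rewrite hPi// PbE hPhi// -EFinM; congr EFin.
  by field; rewrite !gt_eqF.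
have [J [PbJ PhiJ JD]] := disintegration PiE.
have J1 := prob_kernel (s := J).
have Phi1 k : Phi k [set: Z k] = 1%E by exact: probability_setT.
have Pi1 : Pi [set: Xsp Z k0] = 1%E by exact: probability_setT.
have Pb1 : Pibar [set: discK k0] = 1%E by exact: probability_setT.
have PiP : kinv Pi P Pi := kinv_sets hPinv.
have PhiPk k : kinv (Phi k) (Pk k) (Phi k) := kinv_sets (@hi k).
pose D : R.-pker Xsp Z k0 ~> discK k0 := kdirac (@measurable_projX K k0 d Z).
have PiD : kinv Pi D Pibar.
  move=> h mh h0; rewrite -PbJ//.
  - apply: eq_integral => k _; rewrite JD//.
    by rewrite integral_dirac// diracT mul1e.
  - exact: measurable_integral_ker.
  - by move=> x; exact: integral_ge0.
have PbPhi (h : Xsp Z k0 -> \bar R) : measurable_fun setT h -> (forall x, 0 <= h x)%E ->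
    (\int[Pibar]_k \int[Phi (k : K)]_z h (injX k0 z) = \int[Pi]_x h x)%E.
  move=> mh h0; rewrite -PbJ//; apply: eq_integral => k _; rewrite -PhiJ//.
  by apply: eq_integral => z _; rewrite integral_dirac// diracT mul1e.
(* [P1 x] is the law of the block index after one step from [x]. *)
have [P1 [P1E P1h]] := ker_comp_ex P D.
have P1set x (k : discK k0) : (P1 x [set k] = P x (rect k0 [set: Z k]))%E.
  rewrite P1E -preimage_projX.
  transitivity (\int[P x]_y (\1_((@projX K k0 d Z) @^-1` [set k]) y)%:E)%E.
    by apply: eq_integral.
  rewrite integral_indic ?setIT//.
  by rewrite -[X in measurable X]setTI; exact: measurable_projX.
have P1T x : P1 x [set: discK k0] = 1%E.
  rewrite P1E; transitivity (\int[P x]_y cst 1 y)%E.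
    by apply: eq_integral => y _; exact: prob_kernel.
  by rewrite integral_cst// prob_kernel mule1.
have PiP1 : kinv Pi P1 Pibar.
  move=> h mh h0; under eq_integral do rewrite P1h//.
  rewrite PiP ?PiD//; first exact: measurable_integral_ker.
  by move=> x; exact: integral_ge0.
have q0 := Pbar_ge0 Psi P.
have hq (k k' : discK k0) : (Pibar [set k] * (Pbar Psi P k k')%:E =
    \int[Pi]_x (P1 x [set k] * P1 x [set k']))%E.
  rewrite (Pbar_balance P tot0 PsiPhi Pb0 PbPhi).
  by apply: eq_integral => x _; rewrite !P1set.
(* [Q] realises [Pbar] as a Markov kernel equal to [P1^* P1]. *)
have [Q [QE Q1 PbQ QT]] := reversible_matrix_ker P1T PiP1 Pb1 Pb0 q0 hq.
have OpQ := Pbar_op_kint q0 QE.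
have mOpQ f : L2 Pibar f -> measurable_fun setT (Pbar_op Psi P f) by [].
have OpQE f : L2 Pibar f ->
    {ae Pibar, forall k, kint Q f k = Pbar_op Psi P f k}.
  by move=> _; apply: aeW => k; rewrite OpQ.
set lam := fine (opnorm Pibar _).
have lam0 : 0 <= lam by exact: fine_opnorm_ge0.
have lam1 : lam <= 1 by exact: (fine_opnorm_le1 Pb1 Q1 PbQ mOpQ OpQE).
have [S [SE S1 Sw SL]] := kernel_power P t.
have PiS := Sw _ PiP; have OpS := SL _ PiP.
have mOpS f : L2 Pi f -> measurable_fun setT (iter t (kop P) f).
  by move=> [mf _]; exact: measurable_iter_kop.
pose T k := projT1 (cid (kernel_power (Pk k) t)).
have TP k := projT2 (cid (kernel_power (Pk k) t)).
have TE k : forall h, measurable_fun [set: Z k] h -> (forall x, 0 <= h x)%E ->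
    forall x, (\int[T k x]_y h y)%E = kiter (Pk k) t h x by case: (TP k).
have T1 k z : T k z [set: Z k] = 1%E by case: (TP k).
have PhiT k : kinv (Phi k) (T k) (Phi k) by case: (TP k) => _ _ + _; apply.
pose OpT k := iter t (kop (Pk k)).
have mOpT k f : L2 (Phi k) f -> measurable_fun setT (OpT k f).
  by move=> [mf _]; exact: measurable_iter_kop.
have OpTE k f : L2 (Phi k) f -> {ae Phi k, forall z, kint (T k) f z = OpT k f z}.
  by case: (TP k) => _ _ _ + Lf; apply => //; exact: PhiPk.
pose sg k := fine (opnorm (Phi k) (OpT k)).
have sg0 k : 0 <= sg k := fine_opnorm_ge0 (OpT k) (Phi1 k).
have sg1 k : sg k <= 1 by exact: (fine_opnorm_le1 (Phi1 k) (@T1 k) (@PhiT k) (@mOpT k) (@OpTE k)).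
(* On a whole block the minorization bounds [c k] by a probability. *)
have c1 k : c k <= 1.
  rewrite -lee_fin -[leLHS]mule1.
  apply: (@le_trans _ _ ((c k)%:E * Pk k point [set: Z k])%E).
    by rewrite prob_kernel.
  apply: (le_trans (hiii k _ _ measurableT)).
  rewrite -(prob_kernel (s := P) (injX k0 (point : Z k))).
  by apply: le_measure; rewrite ?inE//; exact: measurable_rect.
(* The witness [k0] and the bounds 0 and 1 ensure that neither [inf] nor [sup] takes a default
   value. *)
set Ci := inf _; set ss := sup _.
have Ci0 : 0 <= Ci.
  apply: lb_le_inf; first by exists (c k0 ^+ t); exists k0.
  by move=> _ [k _ <-]; rewrite exprn_ge0// ltW.
have Cile k : Ci <= c k ^+ t.
  apply: ge_inf; last by exists k.
  by exists 0 => _ [j _ <-]; rewrite exprn_ge0// ltW.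
have Ci1 : Ci <= 1 by apply: (le_trans (Cile k0)); rewrite exprn_ile1// ltW.
have ssle k : sg k ^+ 2 <= ss.
  apply: ub_le_sup; last by exists k.
  by exists 1 => _ [j _ <-]; apply: exprn_ile1; [exact: sg0|exact: sg1].
have ss1 : ss <= 1.
  apply: ge_sup; first by exists (sg k0 ^+ 2); exists k0.
  by move=> _ [j _ <-]; apply: exprn_ile1; [exact: sg0|exact: sg1].
have ss0 : 0 <= ss by apply: le_trans (ssle k0); rewrite sqr_ge0.
set a := Ci ^+ 2 * (1 - ss).
have a0 : 0 <= a by rewrite mulr_ge0 ?sqr_ge0// subr_ge0.
have Ci21 : Ci ^+ 2 <= 1 by rewrite exprn_ile1.
have a1 : a <= 1 by rewrite mulr_ile1 ?sqr_ge0// ?subr_ge0// gerBl.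
(* The variance comparison requires only one factor [c k ^+ t]; the square in [a] is absorbed by
   [Ci ^+ 2 <= Ci], valid as [Ci <= 1]. *)
have a_le k : a <= c k ^+ t * (1 - sg k ^+ 2).
  apply: ler_pM; rewrite ?sqr_ge0 ?subr_ge0// ?lerB//.
  by apply: le_trans (Cile k); rewrite expr2 ler_piMl.
have ct0 k : 0 < c k ^+ t by rewrite exprn_gt0.
have minor k (z : Z k) (h : Xsp Z k0 -> \bar R) :
    measurable_fun setT h -> (forall x, 0 <= h x)%E ->
    ((c k ^+ t)%:E * \int[T k z]_u h (injX k0 u) <= \int[S (injX k0 z)]_x h x)%E.
  move=> mh h0; have mhi : measurable_fun [set: Z k] (h \o @injX K d Z k0 k).
    by apply: measurableT_comp => //; exact: measurable_injX.
  rewrite SE// (TE k _ mhi (fun u => h0 _)).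
  apply: (kiter_minorization (@measurable_injX K k0 d Z k)) => // z' A mA.
  have mB : measurable ((@injX K d Z k0 k) @^-1` A).
    by rewrite -[X in measurable X]setTI; exact: measurable_injX.
  apply: (le_trans (hiii k z' _ mB)); apply: le_measure; rewrite ?inE//.
    exact: measurable_rect.
  by move=> _ [u Au <-].
have gap k (h : Z k -> R) : L2 (Phi k) h -> \int[Phi k]_z h z = 0 ->
    ip (Phi k) (kint (T k) h) (kint (T k) h) <= sg k ^+ 2 * ip (Phi k) h h.
  move=> Lh h0.
  rewrite -(ip_op (@mOpT k) (@OpTE k) Lh Lh).
  exact: (opnorm_bound (Phi1 k) (@T1 k) (@PhiT k) (@mOpT k) (@OpTE k)).
have VC := variance_comparison (Y := discK k0) PbJ J1 PhiJ Phi1 S1 PiS T1 PhiT ct0 minor gap a_le.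
set M4 := fine (opnorm Pi _) ^+ 4.
(* [near_maximiser_bound] takes the squared norm of [P^t] as [M], whence the fourth power. *)
have -> : M4 = (fine (opnorm Pi (iter t (kop P))) ^+ 2) ^+ 2 by rewrite -exprM.
have oM0 := fine_opnorm_ge0 (iter t (kop P)) Pi1.
have oM1 := fine_opnorm_le1 Pi1 S1 PiS mOpS OpS.
rewrite lerBrDr addrC -lerBrDr; apply: near_maximiser_bound => //.
- by rewrite sqr_ge0.
- by rewrite exprn_ile1.
move=> eps eps0.
have [f [Lf f0 f1 fM]] := opnorm_approx Pi1 S1 PiS mOpS OpS eps0.
pose Op := iter t (kop P).
pose e := kint J f.
have [Le _] := kint_contract PbJ J1 Lf.
have e0 : \int[Pibar]_k e k = 0.
  by have [_ ->] := kint_integrable PbJ (L2_integrable Pi1 Lf).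
(* [e] is [E f] on the index set and [g] its lift to the whole space; by [fg] and [gg], [<f, E f>]
   and [||E f||^2] both equal [ip Pibar e e]. *)
pose g := e \o (@projX K k0 d Z).
have [Lg gg] := ip_block PiD Le Le.
have fg := ip_proj PbJ J1 JD PiD Lf Le.
have g0 : \int[Pi]_x g x = 0.
  have [_] := kint_integrable PiD (L2_integrable Pb1 Le).
  by rewrite kint_kdirac// e0.
exists (ip Pi f f), (ip Pi (Op f) (Op f)), (ip Pi (Op f) (Op g)),
  (ip Pi (Op g) (Op g)), (ip Pibar e e).
have LOf := L2_op S1 PiS mOpS OpS Lf; have LOg := L2_op S1 PiS mOpS OpS Lg.
split; rewrite ?ip_ge0//.
- by rewrite (ip_op mOpS OpS)//; exact: VC.
- split; last exact: ip_cauchy_schwarz.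
  (* Since [t] is positive, one step can be kept for the block matrix while the other [t.-1] steps
     only contract. *)
  have t1 : t = t.-1.+1 by rewrite prednK.
  have [LPg _] := kint_contract PiP (prob_kernel (s := P)) Lg.
  have [_ le1] := iter_kop_contract t.-1 PiP LPg.
  rewrite /Op [X in iter X]t1 iterSr; apply: (le_trans le1).
  have mPe : measurable_fun setT (kint P1 e) by exact: measurable_kint.
  have aeP : {ae Pi, forall x, kint P g x = kint P1 e x}.
    apply: filterS (ae_ker_L2 PiP1 Le) => x Lx.
    have PxD : kinv (P x) D (P1 x) by move=> h mh h0; rewrite P1h.
    have [_] := kint_integrable PxD (L2_integrable (P1T x) Lx).
    by rewrite kint_kdirac.
  rewrite (ae_ip LPg.1 mPe LPg.1 mPe aeP aeP) -(ip_reversible P1T PiP1 Q1 PbQ QT Le).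
  have [LQe _] := kint_contract PbQ Q1 Le.
  (* The chain [<e, Q e> <= ||e|| ||Q e|| <= lam ||e||^2], carried out on squares; [lam] applies
     because [e] has mean 0. *)
  have := ip_cauchy_schwarz Le LQe.
  have := opnorm_bound Pb1 Q1 PbQ mOpQ OpQE Le e0.
  rewrite OpQ -/lam => b1 b2.
  have : ip Pibar e (kint Q e) ^+ 2 <= (lam * ip Pibar e e) ^+ 2.
    apply: (le_trans b2); rewrite exprMn [_ ^+ 2 in leRHS]expr2.
    rewrite (le_trans (ler_wpM2l (ip_ge0 _ _) b1))//.
    by rewrite le_eqVlt; apply/orP; left; apply/eqP; ring.
  move=> b3; rewrite leNgt; apply/negP => b4.
  have : 0 <= lam * ip Pibar e e by rewrite mulr_ge0// ip_ge0.
  nra.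
(* Both [f] and [g] have mean 0, so the norm of [P^t] controls every combination of them. *)
- move=> tau; rewrite -(ip_op_DZ S1 PiS mOpS OpS tau Lf Lg).
  have -> : ip Pi f f + 2 * tau * ip Pibar e e + tau ^+ 2 * ip Pibar e e =
      ip Pi (fun x => f x + tau * g x) (fun x => f x + tau * g x).
    by rewrite ip_DZ// fg gg.
  apply: (opnorm_bound Pi1 S1 PiS mOpS OpS); first exact: L2D Lf (L2Z _ Lg).
  rewrite (RintegralD measurableT (L2_integrable Pi1 Lf) (L2_integrable Pi1 (L2Z tau Lg))).
  by rewrite (RintegralZl tau measurableT (L2_integrable Pi1 Lg)) f0 g0 mulr0 addr0.
Qed.
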